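(* Let $\delta>0$, let $N,K,s$ be positive integers, and let $\{V_k\}_{k=1}^K$ be a family of random, independent subspaces of $\mathbb R^N$, each having a distribution that is invariant under unitaries, with dimensions $s_k=\dim V_k$ satisfying $s_k\le s$ for all $k$. Let $M=\sum_{k=1}^K s_k$. Then with probability at least $$1-2\left(1+\frac4\delta\right)^N e^{-M\delta^2/4+M\delta^3/3}-2K\left(1+\frac4\delta\right)^s e^{-N\delta^2/4+N\delta^3/3}$$ the family $\{V_j,1\}_{j=1}^K$ is a fusion frame for $\mathbb R^N$ with lower frame bound $\frac{M}{N(1+\delta)^6}$ and upper frame bound $\frac{M(1+\delta)^6}{N}$.
   Context: A family of subspaces $\{W_i\}_{i=1}^K$ of $\mathbb R^N$ with weights $v_i>0$ is a fusion frame $\{W_i,v_i\}_{i=1}^K$ with lower and upper frame bounds $0<A\le B<\infty$ if $A\|x\|^2\le\sum_{i=1}^K v_i^2\|P_ix\|^2\le B\|x\|^2$ for all $x\in\mathbb R^N$, where $P_i$ is the orthogonal projection onto $W_i$. Here all weights equal $1$. The dimensions $s_k$ are fixed (non-random). A random $s_k$-dimensional subspace $V_k$ has a unitarily invariant distribution if $UV_k$ has the same distribution as $V_k$ for every orthogonal (real unitary) transformation $U$ of $\mathbb R^N$. *)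

(* Defs.v *)
From HB Require Import structures.
From mathcomp Require Import all_boot all_order all_algebra.
From mathcomp Require Import all_classical all_reals all_analysis.

Set Implicit Arguments.
Unset Strict Implicit.
Unset Printing Implicit Defensive.

Import Order.TTheory GRing.Theory Num.Theory.
Import numFieldNormedType.Exports.

Local Open Scope classical_set_scope.
Local Open Scope ring_scope.

Section Euclidean.
Variables (R : realType) (N : nat).
Implicit Types (x y : 'rV[R]_N) (W : {vspace 'rV[R]_N}).

Definition dot x y : R := \sum_i x 0 i * y 0 i.

Fact dot_bilinear : bilinear_for *%R (@idfun R \; *%R) dot.
Proof.
split=> z a x y; rewrite /dot /= mulr_sumr -big_split; apply: eq_bigr => i _.
  by rewrite !mxE mulrDl mulrA.
by rewrite !mxE mulrDr mulrCA.
Qed.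

HB.instance Definition _ := bilinear_isBilinear.Build R _ _ R
  (GRing.Scale.Law.clone _ _ *%R _)
  (GRing.Scale.Law.clone _ _ (@idfun R \; *%R) _)
  dot dot_bilinear.

Fact dot_sym x y : dot x y = (-1) ^+ false * idfun (dot y x).
Proof. by rewrite mul1r; apply: eq_bigr => i _; rewrite mulrC. Qed.

HB.instance Definition _ :=
  isHermitianSesquilinear.Build R _ false (@idfun R) dot dot_sym.

Fact dot_pos x : x != 0 -> 0 < dot x x.
Proof.
move=> x0; have dge0 i : true -> 0 <= x 0 i * x 0 i by rewrite -expr2 sqr_ge0.
rewrite lt0r sumr_ge0 // andbT; apply: contraNneq x0 => d0.
apply/eqP/rowP => i; rewrite mxE; apply/eqP.
by have /eqP := psumr_eq0P dge0 d0 (erefl : xpredT i); rewrite mulf_eq0 orbb.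
Qed.

HB.instance Definition _ := isDotProduct.Build R _ dot dot_pos.

(* The library's norm on ['rV[R]_N] is the sup norm. *)
Definition enorm x : R := Num.sqrt (dot x x).

Definition orthproj W : 'End('rV[R]_N) := daddv_pi W (orthov dot W).

Lemma capv_orthov W : (W :&: orthov dot W = 0)%VS.
Proof.
apply/eqP; rewrite -subv0; apply/subvP => x; rewrite memv_cap memv0.
case/andP=> xW /mem_orthovP /(_ x xW) /eqP; apply: contraLR => /dot_pos.
by rewrite lt0r => /andP[].
Qed.

Lemma addv_orthov W : (W + orthov dot W = fullv)%VS.
Proof.
pose f x : 'rV[R]_(\dim W) := \row_i dot x (vbasis W)`_i.
have f_lin : linear f.
  by move=> a x y; apply/rowP => i; rewrite !mxE linearPl.
pose L : {linear 'rV[R]_N -> 'rV[R]_(\dim W)} :=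
  HB.pack f (GRing.isLinear.Build R _ _ _ f f_lin).
pose F := linfun L.
have kerF : (lker F <= orthov dot W)%VS.
  apply/subvP => x; rewrite memv_ker lfunE /= => /eqP/rowP fx0.
  apply/mem_orthovP => w /coord_vbasis ->; rewrite linear_sumr big1 //= => i _.
  by have := fx0 i; rewrite !mxE linearZr_LR /= => ->; rewrite mulr0.
apply/eqP; rewrite eqEdim subvf dimv_disjoint_sum ?capv_orthov //.
rewrite -(limg_ker_dim F) capfv addnC leq_add ?dimvS //.
by rewrite (leq_trans (dimvS (subvf _))) // dimvf /dim /= mul1n.
Qed.

Lemma orthprojP W x : orthproj W x \in W /\
  {in W, forall w, dot (x - orthproj W x) w = 0}.
Proof.
split; first exact: memv_pi.
have := daddv_pi_add (capv_orthov W) (_ : x \in _).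
rewrite addv_orthov memvf => /(_ isT) E.
suff: x - orthproj W x \in orthov dot W by move/mem_orthovP.
by rewrite -{1}E addrAC subrr add0r memv_pi.
Qed.

(* In finite dimension an isometric endomorphism is a bijection, so these are
   the orthogonal transformations of R^N. *)
Definition orthogonal_transformation (U : 'End('rV[R]_N)) : Prop :=
  isometry dot dot U.

Definition fusion_frame (K : nat) (W : 'I_K -> {vspace 'rV[R]_N})
    (v : 'I_K -> R) (A B : R) : Prop :=
  [/\ forall i, 0 < v i, 0 < A, A <= B &
    forall x, A * enorm x ^+ 2
                <= \sum_(i < K) v i ^+ 2 * enorm (orthproj (W i) x) ^+ 2
                <= B * enorm x ^+ 2].

(* Borel sigma-algebra of the space of subspaces under the usual identification
   of a subspace with its orthogonal projection: it is generated by the matrix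
   coefficients of the projection. *)
Definition subspace_generators : set (set {vspace 'rV[R]_N}) :=
  \bigcup_(xj in [set: 'rV[R]_N * 'I_N])
    preimage_set_system [set: {vspace 'rV[R]_N}]
      (fun W => orthproj W xj.1 0 xj.2) measurable.

HB.instance Definition _ := isPointed.Build {vspace 'rV[R]_N} 0%VS.

Definition subspaces := g_sigma_algebraType subspace_generators.

HB.instance Definition _ := Measurable.on subspaces.

End Euclidean.

Section RandomSubspaces.
Context (d : measure_display) (T : measurableType d) (R : realType).
Variables (P : probability T R) (N : nat).

Definition unitarily_invariant (V : {RV P >-> subspaces R N}) : Prop :=
  forall U : 'End('rV[R]_N), orthogonal_transformation U ->
  forall E : set (subspaces R N), measurable E ->
    P ((fun w => (U @: V w)%VS : subspaces R N) @^-1` E) = P (V @^-1` E).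

Definition independent_RVs (d' : measure_display) (T' : measurableType d')
    (I : finType) (X : I -> {RV P >-> T'}) : Prop :=
  forall (J : {set I}) (E : I -> set T'), (forall i, measurable (E i)) ->
    P (\bigcap_(i in [set i | i \in J]) (X i @^-1` E i)) =
    (\prod_(i in J) P (X i @^-1` E i))%E.

End RandomSubspaces.

(* Main.v *)
Require Import Defs.
From HB Require Import structures.
From mathcomp Require Import all_boot all_order all_algebra.
From mathcomp Require Import all_classical all_reals all_analysis.
From mathcomp Require Import measurable_realfun ring lra zify.

(** For fixed [x] the frame sum [X = \sum_k dot (P_k x) x] has independent
    summands between [0] and [|x|^2], and its mean is [M / N * |x|^2]. The theorem
    says that it is close to its mean for all [x] at once.

    One subspace. Let [e] be a unit vector and [a = dot (P e) e], with [P] the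
    projection onto an invariant random subspace of dimension [s]. The law of
    [a] does not depend on [e], so the mean of [expR (u * a)] is stationary when
    [e] is rotated. To second order, summed over the directions of rotation,
    this is a differential inequality for the Laplace transform of [a]
    ([plane_rotation_inequality], [laplace_differential_inequality]): the only
    facts about [P] that enter are that its trace is [s] and that it is a
    symmetric idempotent. Jensen's inequality turns it into
    [E (expR (u * a)) <= expR (u * s / (N - 4 * u))] for every [u < N / 4], of
    either sign ([laplace_bound]).

    One vector. Independence multiplies these bounds ([mean_prod_indep]), and
    Chernoff's method with [w = (1 + delta) ^+ 2] shows that for a unit vector
    [X] leaves the interval from [M / (N * w^2)] to [M * w^2 / N] with
    probability at most twice [expR (- M * (w - 1)^2 / (4 * w^2))]
    ([upper_tail], [lower_tail]). If [delta < 3 / 4], this exponential is at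
    most [expR (- 2 * r * M)], where [r = delta^2 / 4 - delta^3 / 3] is the rate
    in the statement ([tail_rate_ge]).

    All vectors. Blow a vector up to length [n * sqrt N], with [n] about
    [2 / delta], and round its coordinates to integers one by one. A quadratic
    form can be prevented from growing at each step by more than a quarter of
    its diagonal coefficient ([quadratic_rounding]); since the trace of the frame
    operator is the constant [M], bounds on the lattice points of l1 norm at most
    [(n + 1) * N] give bounds for all vectors up to a relative error of order
    [delta^2] ([frame_bounds_of_lattice]), which the sixth power of [1 + delta]
    absorbs. There are at most [(6 * n + 12)^N <= (1 + 4 / delta)^(2 * N)] such
    points ([card_l1_ball_codes], [grid_parameter]).

    Conclusion. With [p = (1 + 4 / delta)^N * expR (- r * M)], the union bound
    makes the failure probability at most [2 * p^2]. If [p < 1 / 2], which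
    forces [delta < 3 / 4], this is at most [2 * p]; otherwise the claimed lower
    bound on the probability is nonpositive. *)

Set Implicit Arguments.
Unset Strict Implicit.
Unset Printing Implicit Defensive.

Import Order.TTheory GRing.Theory Num.Theory.

Local Open Scope classical_set_scope.
Local Open Scope ring_scope.

(** * Orthogonal projections *)

Section Projections.
Context {R : realType} {N : nat}.
Implicit Types (x y z : 'rV[R]_N) (W : {vspace 'rV[R]_N}).

Lemma dotC x y : dot x y = dot y x.
Proof. by apply: eq_bigr => i _; rewrite mulrC. Qed.

Lemma dotDl x y z : dot (x + y) z = dot x z + dot y z.
Proof. by rewrite /dot -big_split; apply: eq_bigr => i _; rewrite mxE mulrDl. Qed.

Lemma dotDr x y z : dot z (x + y) = dot z x + dot z y.
Proof. by rewrite !(dotC z) dotDl. Qed.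

Lemma dotZl a x y : dot (a *: x) y = a * dot x y.
Proof. by rewrite /dot mulr_sumr; apply: eq_bigr => i _; rewrite mxE mulrA. Qed.

Lemma dotZr a x y : dot x (a *: y) = a * dot x y.
Proof. by rewrite dotC dotZl dotC. Qed.

Lemma dot0l x : dot 0 x = 0.
Proof. by rewrite -[0](scale0r x) dotZl mul0r. Qed.

Lemma dotBl x y z : dot (x - y) z = dot x z - dot y z.
Proof. by rewrite dotDl -scaleN1r dotZl mulN1r. Qed.

Lemma dotBr x y z : dot z (x - y) = dot z x - dot z y.
Proof. by rewrite !(dotC z) dotBl. Qed.

Lemma dot_ge0 x : 0 <= dot x x.
Proof. by apply: sumr_ge0 => i _; rewrite -expr2 sqr_ge0. Qed.

Lemma dot_eq0 x : dot x x = 0 -> x = 0.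
Proof.
move=> x0; apply/eqP/negPn/negP => /dot_pos; rewrite x0.
by rewrite ltxx.
Qed.

Lemma enorm_sqr x : enorm x ^+ 2 = dot x x.
Proof. by rewrite sqr_sqrtr // dot_ge0. Qed.

Definition basis_vec (i : 'I_N) : 'rV[R]_N := delta_mx 0 i.

Lemma dot_basisr x i : dot x (basis_vec i) = x 0 i.
Proof.
rewrite /dot (bigD1 i) //= big1 ?addr0; last first.
  by move=> j ji; rewrite mxE eqxx (negbTE ji) mulr0.
by rewrite mxE !eqxx mulr1.
Qed.

Lemma dot_basis i j : dot (basis_vec i) (basis_vec j) = (i == j)%:R.
Proof. by rewrite dot_basisr mxE eqxx eq_sym. Qed.

Lemma orthproj_in W x : orthproj W x \in W.
Proof. by have [] := orthprojP W x. Qed.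

Lemma orthproj_perp W x w : w \in W -> dot (x - orthproj W x) w = 0.
Proof. by have [_] := orthprojP W x; apply. Qed.

Lemma orthproj_unique W x y : y \in W ->
  (forall w, w \in W -> dot (x - y) w = 0) -> orthproj W x = y.
Proof.
move=> yW yperp; apply/eqP; rewrite -subr_eq0; apply/eqP/dot_eq0.
have dW : orthproj W x - y \in W by rewrite memvB // orthproj_in.
have := orthproj_perp x dW; have := yperp _ dW.
by move: {1 2 4}(orthproj W x - y) => w; rewrite !dotBl; lra.
Qed.

Lemma orthproj_id W x : x \in W -> orthproj W x = x.
Proof.
by move=> xW; apply: orthproj_unique => // w _; rewrite subrr dot0l.
Qed.

Lemma dot_orthproj W x y : dot (orthproj W x) y = dot (orthproj W x) (orthproj W y).
Proof.
have := orthproj_perp y (orthproj_in W x); rewrite dotBl => /subr0_eq.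
by rewrite dotC => ->; rewrite dotC.
Qed.

Lemma dot_orthprojC W x y : dot (orthproj W x) y = dot (orthproj W y) x.
Proof. by rewrite dot_orthproj dotC -dot_orthproj. Qed.

Lemma orthproj_le W x : dot (orthproj W x) x <= dot x x.
Proof.
have := dot_ge0 (x - orthproj W x); rewrite dotBl !dotBr.
by rewrite (dotC x (orthproj W x)) -dot_orthproj; lra.
Qed.

Lemma orthproj_ge0 W x : 0 <= dot (orthproj W x) x.
Proof. by rewrite dot_orthproj dot_ge0. Qed.

Lemma dot_isometry (U : 'End('rV[R]_N)) x y :
  orthogonal_transformation U -> dot (U x) (U y) = dot x y.
Proof. exact. Qed.

Lemma orthproj_img U W x : orthogonal_transformation U ->
  orthproj (U @: W) (U x) = U (orthproj W x).
Proof.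
move=> Uiso; apply: orthproj_unique; first by rewrite memv_img ?orthproj_in.
move=> _ /memv_imgP[w wW ->]; rewrite -linearB /= dot_isometry //.
exact: orthproj_perp.
Qed.

(** The witness is the Householder reflection in the hyperplane orthogonal to
    [x - y], which bisects [x] and [y]. *)
Lemma exists_orthogonal_map x y : dot x x = dot y y ->
  exists2 U : 'End('rV[R]_N), orthogonal_transformation U & U x = y.
Proof.
move=> xy; have [->|neq_xy] := eqVneq x y.
  by exists \1%VF => [u v|]; rewrite !lfunE.
have [n nE] : exists n, n = x - y by exists (x - y).
have n0 : dot n n != 0.
  by rewrite lt0r_neq0 // dot_pos // nE subr_eq0.
pose f z : 'rV[R]_N := z - (2 * dot z n / dot n n) *: n.
have f_lin : linear f.
  move=> a u v; apply/rowP => i; rewrite /f dotDl dotZl !mxE.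
  by field.
pose L : {linear 'rV[R]_N -> 'rV[R]_N} :=
  HB.pack f (GRing.isLinear.Build R _ _ _ f f_lin).
exists (linfun L).
  move=> u v; change (dot (linfun L u) (linfun L v) = dot u v).
  rewrite !lfunE /= /f !(dotBl, dotBr, dotZl, dotZr).
  by rewrite (dotC n v); field.
rewrite lfunE /= /f.
have -> : 2 * dot x n / dot n n = 1.
  apply: (mulIf n0); rewrite divfK // mul1r nE !(dotBl, dotBr) (dotC y x) -xy.
  ring.
by rewrite scale1r nE opprB addrC subrK.
Qed.

(** Let [B] have the vectors of a basis of [W] as rows and let [C] hold the
    coordinates in that basis of the projected standard basis. Then [C *m B] is
    the matrix of the projection, whereas [B *m C] is the identity because the
    projection fixes [W]; the two products have the same trace. *)
Lemma trace_orthproj W :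
  \sum_i dot (orthproj W (basis_vec i)) (basis_vec i) = (\dim W)%:R :> R.
Proof.
pose b := vbasis W.
pose B : 'M[R]_(\dim W, N) := \matrix_(i, j) b`_i 0 j.
pose C : 'M[R]_(N, \dim W) :=
  \matrix_(i, j) coord b j (orthproj W (basis_vec i)).
have CB i j : (C *m B) i j = orthproj W (basis_vec i) 0 j.
  rewrite [in RHS](coord_vbasis (orthproj_in W (basis_vec i))) mxE summxE.
  by apply: eq_bigr => k _; rewrite !mxE.
have E x : x = \sum_i x 0 i *: basis_vec i by exact: row_sum_delta.
have BC : B *m C = 1%:M.
  apply/matrixP => i j; rewrite !mxE.
  have biW : b`_i \in W by apply: vbasis_mem; rewrite mem_nth // size_tuple.
  transitivity (coord b j (orthproj W b`_i)).
    rewrite [in RHS](E b`_i) !linear_sum; apply: eq_bigr => k _.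
    by rewrite !linearZ /= !mxE.
  by rewrite orthproj_id // coord_free // ?(basis_free (vbasisP W)) //.
transitivity (\tr (C *m B)).
  by apply: eq_bigr => i _; rewrite CB dot_basisr.
by rewrite mxtrace_mulC BC mxtrace1.
Qed.

Lemma sum_sqr_coord x y :
  \sum_i dot x (basis_vec i) * dot y (basis_vec i) = dot x y.
Proof. by apply: eq_bigr => i _; rewrite !dot_basisr. Qed.

End Projections.

Section Measurability.
Context {R : realType} {N : nat}.

Lemma measurable_orthproj_coord (x : 'rV[R]_N) (j : 'I_N) :
  measurable_fun [set: subspaces R N] (fun W => orthproj W x 0 j).
Proof.
move=> _ B mB; rewrite setTI; apply: sub_sigma_algebra.
by exists (x, j) => //; exists B; rewrite ?setTI.
Qed.

Lemma measurable_dot_orthproj (x y : 'rV[R]_N) :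
  measurable_fun [set: subspaces R N] (fun W => dot (orthproj W x) y).
Proof.
apply: measurable_sum => j; apply: measurable_funM => //.
exact: measurable_orthproj_coord.
Qed.

End Measurability.

(** * Expectation of bounded random variables *)

Section BoundedExpectation.
Context {d : measure_display} {T : measurableType d} {R : realType}.
Variable P : probability T R.

Lemma bounded_integrable (f : T -> R) (C : R) : measurable_fun setT f ->
  (forall w, `|f w| <= C) -> P.-integrable setT (EFin \o f).
Proof.
move=> mf fC; apply: measurable_bounded_integrable => //.
  exact: le_lt_trans (probability_le1 P measurableT) (ltry 1).
exists C; split; first exact: num_real.
by move=> x Cx w _; apply: le_trans (fC w) (ltW Cx).
Qed.

(** The two expectations are integrals against the image measures of [X] and
    [Y], which coincide. *)
Lemma equal_law_expectation (X Y : T -> R) (f : R -> R) :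
  measurable_fun setT X -> measurable_fun setT Y ->
  (forall B, measurable B -> P (X @^-1` B) = P (Y @^-1` B)) ->
  measurable_fun setT f -> (forall x, 0 <= f x) ->
  \int[P]_w f (X w) = \int[P]_w f (Y w).
Proof.
move=> mX mY XY mf f0; rewrite /Rintegral; congr fine.
move/measurable_EFinP: mf => mfE.
transitivity (\int[pushforward P X]_y (EFin \o f) y)%E.
  rewrite ge0_integral_pushforward ?preimage_setT // => y _.
  by rewrite /= lee_fin.
transitivity (\int[pushforward P Y]_y (EFin \o f) y)%E.
  by apply: eq_measure_integral => B mB _; exact: XY.
rewrite ge0_integral_pushforward ?preimage_setT // => y _.
by rewrite /= lee_fin.
Qed.

End BoundedExpectation.

Section BoundedRandomVariables.
Context {d : measure_display} {T : measurableType d} {R : realType}.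
Variable P : probability T R.
Implicit Types f g : T -> R.

(** All expectations below are taken of bounded random variables, a class that
    is closed under the algebraic operations and on which the mean is linear. *)
Definition bounded_rv f :=
  measurable_fun setT f /\ exists C : R, forall w, `|f w| <= C.

Lemma bounded_rv_integrable f : bounded_rv f -> P.-integrable setT (EFin \o f).
Proof. by case=> mf [C fC]; exact: bounded_integrable mf fC. Qed.

Lemma bounded_rv_cst r : bounded_rv (fun=> r).
Proof. by split; [exact: measurable_cst | exists `|r|]. Qed.

Lemma bounded_rvD f g : bounded_rv f -> bounded_rv g ->
  bounded_rv (fun w => f w + g w).
Proof.
case=> mf [C fC] [mg [D gD]]; split; first exact: measurable_funD.
by exists (C + D) => w; rewrite (le_trans (ler_normD _ _)) // lerD.
Qed.

Lemma bounded_rvM f g : bounded_rv f -> bounded_rv g ->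
  bounded_rv (fun w => f w * g w).
Proof.
case=> mf [C fC] [mg [D gD]]; split; first exact: measurable_funM.
by exists (C * D) => w; rewrite normrM ler_pM.
Qed.

Lemma bounded_rvZ r f : bounded_rv f -> bounded_rv (fun w => r * f w).
Proof. exact/bounded_rvM/bounded_rv_cst. Qed.

Lemma bounded_rvB f g : bounded_rv f -> bounded_rv g ->
  bounded_rv (fun w => f w - g w).
Proof.
move=> bf bg; have := bounded_rvD bf (bounded_rvZ (-1) bg).
by under eq_fun do rewrite mulN1r.
Qed.

Lemma bounded_rvX f n : bounded_rv f -> bounded_rv (fun w => f w ^+ n).
Proof.
move=> bf; elim: n => [|n IHn].
  by under eq_fun do rewrite expr0; exact: bounded_rv_cst.
by under eq_fun do rewrite exprS; exact: bounded_rvM.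
Qed.

Lemma bounded_rv_expR f : bounded_rv f -> bounded_rv (fun w => expR (f w)).
Proof.
case=> mf [C fC]; split.
  by apply: measurableT_comp mf; exact: measurable_expR.
exists (expR C) => w; rewrite ger0_norm ?expR_ge0 // ler_expR.
exact: le_trans (ler_norm _) (fC w).
Qed.

Lemma bounded_rv_sum (I : Type) (r : seq I) (Q : pred I) (F : I -> T -> R) :
  (forall i, bounded_rv (F i)) -> bounded_rv (fun w => \sum_(i <- r | Q i) F i w).
Proof.
move=> bF; elim: r => [|i r IHr].
  rewrite (_ : (fun _ => _) = fun=> 0); first exact: bounded_rv_cst.
  by apply/funext => w; rewrite big_nil.
have [Qi|Qi] := boolP (Q i).
  rewrite (_ : (fun _ => _) = fun w => F i w + \sum_(j <- r | Q j) F j w).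
    exact: bounded_rvD.
  by apply/funext => w; rewrite big_cons Qi.
rewrite (_ : (fun _ => _) = fun w => \sum_(j <- r | Q j) F j w) //.
by apply/funext => w; rewrite big_cons (negbTE Qi).
Qed.

Lemma mean_cst r : \int[P]_w (fun=> r) w = r.
Proof.
transitivity (r * fine (P setT)); first exact: Rintegral_cst.
by rewrite probability_setT mulr1.
Qed.

Lemma meanD f g : bounded_rv f -> bounded_rv g ->
  \int[P]_w (f w + g w) = \int[P]_w f w + \int[P]_w g w.
Proof. by move=> bf bg; apply: RintegralD => //; exact: bounded_rv_integrable. Qed.

Lemma meanB f g : bounded_rv f -> bounded_rv g ->
  \int[P]_w (f w - g w) = \int[P]_w f w - \int[P]_w g w.
Proof. by move=> bf bg; apply: RintegralB => //; exact: bounded_rv_integrable. Qed.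

Lemma meanZ r f : bounded_rv f ->
  \int[P]_w (r * f w) = r * \int[P]_w f w.
Proof. by move=> bf; apply: RintegralZl => //; exact: bounded_rv_integrable. Qed.

Lemma mean_le f g : bounded_rv f -> bounded_rv g ->
  (forall w, f w <= g w) -> \int[P]_w f w <= \int[P]_w g w.
Proof.
by move=> bf bg fg; apply: le_Rintegral => //; exact: bounded_rv_integrable.
Qed.

Lemma mean_sum (I : Type) (r : seq I) (Q : pred I) (F : I -> T -> R) :
  (forall i, bounded_rv (F i)) ->
  \int[P]_w (\sum_(i <- r | Q i) F i w) = \sum_(i <- r | Q i) \int[P]_w F i w.
Proof.
move=> bF; elim: r => [|i r IHr].
  rewrite big_nil -[RHS]mean_cst.
  by apply: eq_Rintegral => w _; rewrite big_nil.
rewrite big_cons -IHr; have [Qi|Qi] := boolP (Q i).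
  rewrite -meanD //; last exact: bounded_rv_sum.
  by apply: eq_Rintegral => w _; rewrite big_cons Qi.
by apply: eq_Rintegral => w _; rewrite big_cons (negbTE Qi).
Qed.

End BoundedRandomVariables.

(** * Elementary real inequalities *)

Section RealInequalities.
Context {R : realType}.

(** Squaring [1 - v / 2 <= expR (- (v / 2))] bounds [expR v] by
    [(1 - v / 2) ^- 2], and
    [(1 + v + v ^+ 2) * (1 - v / 2) ^+ 2 - 1]
    is [v ^+ 2 / 4 * (1 - 3 * v + v ^+ 2)]. *)
Lemma expR_le_quadratic (v : R) : v <= 1 / 3 -> expR v <= 1 + v + v ^+ 2.
Proof.
move=> v3; have h0 : 0 < 1 - v / 2 by lra.
have h : 1 - v / 2 <= expR (- (v / 2)) by exact: expR_ge1Dx.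
have : expR v * (1 - v / 2) ^+ 2 <= 1.
  have -> : expR v = expR (v / 2) ^+ 2.
    by rewrite expr2 -expRD -splitr.
  have e1 : expR (v / 2) * (1 - v / 2) <= 1.
    by rewrite -[leRHS](expRxMexpNx_1 (v / 2)) ler_pM2l ?expR_gt0.
  by rewrite -exprMn exprn_ile1 // mulr_ge0 ?expR_ge0 // ltW.
move: (expR v) => E E1.
have h2 : 0 < (1 - v / 2) ^+ 2 by rewrite exprn_gt0.
rewrite -(ler_pM2r h2); apply: le_trans E1 _.
rewrite -subr_ge0.
have -> : (1 + v + v ^+ 2) * (1 - v / 2) ^+ 2 - 1
  = v ^+ 2 / 4 * (1 - 3 * v + v ^+ 2) by field.
by rewrite mulr_ge0 ?divr_ge0 ?sqr_ge0 //; have := sqr_ge0 v; lra.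
Qed.

Lemma ge0_of_small_perturbation (x0 I K : R) : 0 < x0 -> 0 <= K ->
  (forall x, 0 < x -> x <= x0 -> 0 <= I + x * K) -> 0 <= I.
Proof.
move=> x0_gt0 K0 H; rewrite leNgt; apply/negP => I0.
have K1 : 0 < K + 1 by lra.
pose x := Num.min x0 (- I / (K + 1) / 2).
have x_gt0 : 0 < x by rewrite lt_min x0_gt0 !divr_gt0 //; lra.
have := H x x_gt0; rewrite ge_min lexx => /(_ isT).
have : x <= - I / (K + 1) / 2 by rewrite ge_min lexx orbT.
rewrite -(ler_pM2r K1) mulrAC divfK ?gt_eqF // => hx.
nra.
Qed.

End RealInequalities.

(** * The Laplace transform of one invariant subspace *)

Section InvariantSubspace.
Context {d : measure_display} {T : measurableType d} {R : realType}.
Context {P : probability T R} {N : nat}.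
Variable V : {RV P >-> subspaces R N}.
Hypothesis V_inv : unitarily_invariant V.
Implicit Types x y e f : 'rV[R]_N.

Lemma measurable_proj_coef x y :
  measurable_fun setT (fun w => dot (orthproj (V w) x) y).
Proof.
exact: (measurableT_comp (measurable_dot_orthproj x y) (measurable_funPT V)).
Qed.

Lemma dot_orthproj_bound (W : {vspace 'rV[R]_N}) x y :
  `|dot (orthproj W x) y| <= (dot x x + dot y y) / 2.
Proof.
have := orthproj_ge0 W (x + y); have := orthproj_ge0 W (x - y).
rewrite linearB linearD /= !(dotBl, dotBr, dotDl, dotDr).
rewrite (dot_orthprojC W y x).
have := orthproj_le W x; have := orthproj_le W y.
by rewrite ler_norml => *; apply/andP; split; lra.
Qed.

Lemma bounded_proj_coef x y : bounded_rv (fun w => dot (orthproj (V w) x) y).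
Proof.
split; first exact: measurable_proj_coef.
by eexists => w; exact: dot_orthproj_bound.
Qed.

(** If the orthogonal map [U] sends [x] to [y], the quadratic form of the
    projection onto [V] at [x] is that of the projection onto [U @: V] at [y],
    and [U @: V] has the law of [V]. *)
Lemma invariant_law x y (B : set R) : dot x x = dot y y -> measurable B ->
  P ((fun w => dot (orthproj (V w) x) x) @^-1` B) =
  P ((fun w => dot (orthproj (V w) y) y) @^-1` B).
Proof.
move=> xy mB; have [U Uiso <-] := exists_orthogonal_map xy.
set E : set (subspaces R N) := (fun W => dot (orthproj W (U x)) (U x)) @^-1` B.
have mE : measurable E.
  by rewrite -[E]setTI; apply: measurable_dot_orthproj.
rewrite -[RHS]/(P (V @^-1` E)) -(V_inv Uiso mE); congr (P _).
apply/funext => w; rewrite /preimage /E /=.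
by rewrite orthproj_img // dot_isometry.
Qed.

Lemma laplace_invariant u x y : dot x x = dot y y ->
  \int[P]_w expR (u * dot (orthproj (V w) x) x) =
  \int[P]_w expR (u * dot (orthproj (V w) y) y).
Proof.
move=> xy; apply: (@equal_law_expectation _ _ _ P
  (fun w => dot (orthproj (V w) x) x) (fun w => dot (orthproj (V w) y) y)
  (fun z => expR (u * z))).
- exact: measurable_proj_coef.
- exact: measurable_proj_coef.
- by move=> B mB; exact: invariant_law.
- by apply: measurableT_comp; [exact: measurable_expR | exact: measurable_funM].
- by move=> z; exact: expR_ge0.
Qed.

(** This is the second-order condition expressing that the mean of
    [expR (u * dot (orthproj V x) x)] does not change when [x] turns from [e]
    towards [f] or towards [- f]. With [a], [b], [c] the coefficients of the
    projection on the plane of [e] and [f], the value at the angle of sine [S]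
    differs from [a] by [S ^+ 2 * (c - a)] plus or minus a term of size
    [2 * S * b]. Averaging the two rotations kills the first-order term, and
    dividing by [S ^+ 2] and letting [S] tend to [0] leaves the integrand below.
    The exact coefficient of [b ^+ 2] would be [2 * u ^+ 2]; the factor [4]
    comes from the crude bound [expR v <= 1 + v + v ^+ 2]. *)
Lemma plane_rotation_inequality u e f :
  dot e e = 1 -> dot f f = 1 -> dot e f = 0 ->
  0 <= \int[P]_w (expR (u * dot (orthproj (V w) e) e) *
    (u * (dot (orthproj (V w) f) f - dot (orthproj (V w) e) e)
     + 4 * u ^+ 2 * dot (orthproj (V w) e) f ^+ 2)).
Proof.
move=> ee ff ef.
pose a w := dot (orthproj (V w) e) e; pose c w := dot (orthproj (V w) f) f.
pose b w := dot (orthproj (V w) e) f.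
have ba : bounded_rv a by exact: bounded_proj_coef.
have bb : bounded_rv b by exact: bounded_proj_coef.
have bc : bounded_rv c by exact: bounded_proj_coef.
have bE : bounded_rv (fun w => expR (u * a w)).
  by apply: bounded_rv_expR; exact: bounded_rvZ.
have bG : bounded_rv (fun w => expR (u * a w) *
    (u * (c w - a w) + 4 * u ^+ 2 * b w ^+ 2)).
  apply: bounded_rvM => //; apply: bounded_rvD; apply: bounded_rvZ.
    exact: bounded_rvB.
  exact: bounded_rvX.
set I := \int[P]_w _; pose phi := \int[P]_w expR (u * a w).
have phi0 : 0 <= phi by apply: Rintegral_ge0 => w _; exact: expR_ge0.
(* [x] is the squared sine; below [x0] every exponent increment is at most 1/3 *)
pose x0 : R := (9 * `|u| + 1) ^- 2.
have u0 := normr_ge0 u.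
have k_gt0 : 0 < 9 * `|u| + 1 by lra.
have x0_gt0 : 0 < x0 by rewrite invr_gt0 exprn_gt0.
suff key (x : R) : 0 < x -> x <= x0 -> 0 <= I + x * (u ^+ 2 * phi).
  apply: (@ge0_of_small_perturbation _ x0 I (u ^+ 2 * phi)) => //.
  by rewrite mulr_ge0 ?sqr_ge0.
move=> x_gt0 x_le.
pose S : R := Num.sqrt x; pose C : R := Num.sqrt (1 - x).
have S2 : S ^+ 2 = x by rewrite sqr_sqrtr // ltW.
have S_gt0 : 0 < S by rewrite sqrtr_gt0.
have S_le : S * (9 * `|u| + 1) <= 1.
  rewrite -(@expr_le1 _ 2) //; last exact: mulr_ge0 (ltW _) (ltW _).
  by rewrite exprMn S2 -ler_pdivlMr ?div1r // exprn_gt0.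
have S1 : S <= 1 by nra.
have x1 : x <= 1 by nra.
have C2 : C ^+ 2 = 1 - x by rewrite sqr_sqrtr //; lra.
have C0 : 0 <= C by exact: sqrtr_ge0.
have C1 : C <= 1 by nra.
pose q (sg : R) w := dot (orthproj (V w) (C *: e + (sg * S) *: f))
                   (C *: e + (sg * S) *: f).
have bq sg : bounded_rv (fun w => expR (u * q sg w)).
  by apply: bounded_rv_expR; apply: bounded_rvZ; exact: bounded_proj_coef.
have qE sg w : sg ^+ 2 = 1 ->
    q sg w = a w + x * (c w - a w) + sg * (2 * C * S * b w).
  move=> sg1; rewrite /q linearD !linearZ /= !(dotDl, dotDr, dotZl, dotZr).
  rewrite (dot_orthprojC (V w) f e) -/(a w) -/(b w) -/(c w).
  transitivity (C ^+ 2 * a w + sg ^+ 2 * S ^+ 2 * c w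
    + sg * (2 * C * S * b w)); first ring.
  by rewrite C2 S2 sg1; ring.
have phiq sg : sg ^+ 2 = 1 -> \int[P]_w expR (u * q sg w) = phi.
  move=> sg1; apply: laplace_invariant.
  rewrite !(dotDl, dotDr, dotZl, dotZr) (dotC f e) ee ff ef.
  transitivity (C ^+ 2 + sg ^+ 2 * S ^+ 2); first ring.
  by rewrite C2 S2 sg1; ring.
have pt w : expR (u * q 1 w) + expR (u * q (-1) w) <=
    2 * (expR (u * a w) + x * (expR (u * a w) *
      (u * (c w - a w) + 4 * u ^+ 2 * b w ^+ 2))
      + u ^+ 2 * x ^+ 2 * expR (u * a w)).
  have a0 : 0 <= a w by exact: orthproj_ge0.
  have c0 : 0 <= c w by exact: orthproj_ge0.
  have a1 : a w <= 1 by rewrite -ee; exact: orthproj_le.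
  have c1 : c w <= 1 by rewrite -ff; exact: orthproj_le.
  have b1 : `|b w| <= 1.
    by have := dot_orthproj_bound (V w) e f; rewrite ee ff; lra.
  pose y := u * (x * (c w - a w)); pose z := u * (2 * C * S * b w).
  have yz : `|y| + `|z| <= 1 / 3.
    have hy : `|y| <= `|u| * S.
      rewrite /y normrM ler_wpM2l // normrM (ger0_norm (ltW x_gt0)).
      have : `|c w - a w| <= 1 by rewrite ler_norml; apply/andP; split; lra.
      by have := normr_ge0 (c w - a w); nra.
    have hz : `|z| <= `|u| * (2 * S).
      rewrite /z normrM ler_wpM2l // !normrM (ger0_norm C0).
      rewrite (ger0_norm (ltW S_gt0)) (ger0_norm (ler0n _ 2)).
      rewrite (_ : _ * `|b w| = 2 * S * (C * `|b w|)); last ring.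
      by rewrite ler_piMr ?mulr_ile1 ?mulr_ge0 ?(ltW S_gt0).
    have : `|u| * S <= 1 / 9 by lra.
    lra.
  have := ler_norm y; have := ler_norm z; have := ler_norm (- z).
  rewrite normrN => z1 z2 y1.
  have e1 : expR (u * q 1 w) <= expR (u * a w) * (1 + (y + z) + (y + z) ^+ 2).
    rewrite qE ?expr1n // (_ : u * _ = u * a w + (y + z)); last first.
      by rewrite /y /z; ring.
    by rewrite expRD ler_pM2l ?expR_gt0 // expR_le_quadratic //; lra.
  have e2 : expR (u * q (-1) w) <= expR (u * a w) * (1 + (y - z) + (y - z) ^+ 2).
    rewrite qE ?sqrrN ?expr1n // (_ : u * _ = u * a w + (y - z)); last first.
      by rewrite /y /z; ring.
    by rewrite expRD ler_pM2l ?expR_gt0 // expR_le_quadratic //; lra.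
  have E0 := expR_gt0 (u * a w).
  apply: (le_trans (lerD e1 e2)).
  move: (expR (u * a w)) E0 => E E0.
  have -> : E * (1 + (y + z) + (y + z) ^+ 2) + E * (1 + (y - z) + (y - z) ^+ 2)
    = 2 * (E * (1 + y + (y ^+ 2 + z ^+ 2))) by ring.
  have -> : E + x * (E * (u * (c w - a w) + 4 * u ^+ 2 * b w ^+ 2))
     + u ^+ 2 * x ^+ 2 * E
    = E * (1 + y + (u ^+ 2 * x ^+ 2 + 4 * x * (u * b w) ^+ 2)).
    by rewrite /y; ring.
  rewrite ler_pM2l // ler_pM2l // lerD2l lerD //.
    have ca : (c w - a w) ^+ 2 <= 1 by nra.
    by rewrite /y mulrA !exprMn ler_piMr // mulr_ge0 ?sqr_ge0.
  have -> : z ^+ 2 = C ^+ 2 * (4 * S ^+ 2 * (u * b w) ^+ 2) by rewrite /z; ring.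
  rewrite S2; apply: ler_piMl; last by rewrite C2; lra.
  by apply: mulr_ge0; [apply: mulr_ge0 => //; exact: ltW | exact: sqr_ge0].
have bR1 := bounded_rvD bE (bounded_rvZ x bG).
have bR2 := bounded_rvZ (u ^+ 2 * x ^+ 2) bE.
have bR := bounded_rvZ 2 (bounded_rvD bR1 bR2).
have := mean_le P (bounded_rvD (bq 1) (bq (-1))) bR pt.
rewrite meanD // phiq ?expr1n // phiq ?sqrrN ?expr1n //.
rewrite meanZ ?meanD //; last by exact: bounded_rvD.
- rewrite !meanZ // -/phi -/I => H.
  rewrite -(ler_pM2l x_gt0) mulr0.
  rewrite (_ : x * (I + _) = x * I + u ^+ 2 * x ^+ 2 * phi); last ring.
  lra.
- exact: bounded_rvZ.
Qed.

End InvariantSubspace.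

Section LaplaceTransform.
Context {d : measure_display} {T : measurableType d} {R : realType}.
Context {P : probability T R} {N : nat}.
Variables (V : {RV P >-> subspaces R N}) (s : nat).
Hypothesis V_inv : unitarily_invariant V.
Hypothesis V_dim : forall w, \dim (V w : {vspace 'rV[R]_N}) = s.
Variables (i0 : 'I_N) (u : R).
Let a w := dot (orthproj (V w) (basis_vec i0)) (basis_vec i0).
Let phi := \int[P]_w expR (u * a w).
Let psi := \int[P]_w (expR (u * a w) * a w).

Let ba : bounded_rv a.
Proof. exact: bounded_proj_coef. Qed.

Let bE : bounded_rv (fun w => expR (u * a w)).
Proof. by apply: bounded_rv_expR; exact: bounded_rvZ. Qed.

Let bEa : bounded_rv (fun w => expR (u * a w) * a w).
Proof. exact: bounded_rvM. Qed.

(** Sum the plane rotation inequality over the standard basis, the fixed vector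
    being [basis_vec i0]. The diagonal coefficients add up to the trace [s], the
    squares of the coefficients of row [i0] add up to [a] since the projection
    is idempotent, and the summand [i = i0] is nonnegative by itself. As [psi] is
    the derivative of the Laplace transform [phi], the result is a differential
    inequality for [phi]. *)
Lemma laplace_differential_inequality :
  u * psi * (N%:R - 4 * u) <= u * s%:R * phi.
Proof.
pose g i w := u * (dot (orthproj (V w) (basis_vec i)) (basis_vec i) - a w)
  + 4 * u ^+ 2 * dot (orthproj (V w) (basis_vec i0)) (basis_vec i) ^+ 2.
have bg i : bounded_rv (fun w => expR (u * a w) * g i w).
  apply: bounded_rvM => //; apply: bounded_rvD; apply: bounded_rvZ.
    by apply: bounded_rvB => //; exact: bounded_proj_coef.
  by apply: bounded_rvX; exact: bounded_proj_coef.
have : 0 <= \sum_i \int[P]_w (expR (u * a w) * g i w).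
  apply: sumr_ge0 => i _; have [->|ii0] := eqVneq i i0.
    apply: Rintegral_ge0 => w _; rewrite mulr_ge0 ?expR_ge0 // /g subrr mulr0 add0r.
    by rewrite -mulrA -exprMn mulr_ge0 ?sqr_ge0.
  apply: plane_rotation_inequality => //; rewrite dot_basis ?eqxx //.
  by rewrite eq_sym (negbTE ii0).
have E w : \sum_i expR (u * a w) * g i w =
    (u * s%:R) * expR (u * a w) - (u * (N%:R - 4 * u)) * (expR (u * a w) * a w).
  rewrite -mulr_sumr /g big_split /= -!mulr_sumr sumrB sumr_const card_ord.
  rewrite trace_orthproj V_dim.
  under [X in _ * (_ + _ * X)]eq_bigr do rewrite expr2.
  rewrite sum_sqr_coord -dot_orthproj -/(a w) -mulr_natl.
  by ring.
rewrite -mean_sum //; under eq_Rintegral do rewrite E.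
rewrite meanB ?meanZ //; [|exact: bounded_rvZ..].
by rewrite -/phi -/psi; lra.
Qed.

Lemma laplace_gt0 : 0 < phi.
Proof.
apply: (lt_le_trans (expR_gt0 (- `|u|))).
rewrite -(mean_cst P (expR (- `|u|))); apply: mean_le => //.
  exact: bounded_rv_cst.
move=> w; rewrite ler_expR.
have a0 : 0 <= a w by exact: orthproj_ge0.
have a1 : a w <= 1.
  by have := orthproj_le (V w) (basis_vec i0); rewrite dot_basis eqxx.
have := ler_norm (- u); rewrite normrN => h.
by have := normr_ge0 u; nra.
Qed.

(** Jensen's inequality for the probability of density [expR (u * a) / phi]: the
    mean of [expR (- (u * a))] is [phi^-1], and the mean of [a] is [psi / phi]. *)
Lemma laplace_le_log_derivative : phi <= expR (u * (psi / phi)).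
Proof.
set m := psi / phi; have phi0 := laplace_gt0.
have psiE : psi = m * phi by rewrite divfK // gt_eqF.
pose c := expR (- (u * m)).
have c0 : 0 < c by exact: expR_gt0.
have : \int[P]_w ((c * (1 + u * m)) * expR (u * a w)
                   - (c * u) * (expR (u * a w) * a w)) <= 1.
  rewrite -[leRHS](mean_cst P 1); apply: mean_le.
  - by apply: bounded_rvB; exact: bounded_rvZ.
  - exact: bounded_rv_cst.
  move=> w; rewrite -[leRHS](expRxMexpNx_1 (u * a w - u * m)) opprB.
  have := expR_ge1Dx (u * m - u * a w); have := expR_gt0 (u * a w).
  rewrite [expR (u * a w - _)]expRD -/c.
  move: (expR (u * a w)) (expR (u * m - _)) => E F E0 EF.
  have : 0 <= E * c * (F - (1 + (u * m - u * a w))).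
    by rewrite !mulr_ge0 ?subr_ge0 // ltW.
  by lra.
rewrite meanB ?meanZ //; [|exact: bounded_rvZ..].
rewrite -/phi -/psi psiE => H.
have cphi : c * phi <= 1 by lra.
rewrite -[leLHS]mul1r -{1}(expRxMexpNx_1 (u * m)) -/c -mulrA.
by rewrite -[leRHS]mulr1 ler_pM2l ?expR_gt0.
Qed.

(** To compare: [s%:R / N%:R] is the mean of [a], so the right-hand side has the
    correct first-order term in [u]. The bound holds for both signs of [u], so
    that it controls the upper and the lower tail. *)
Lemma laplace_bound : 4 * u < N%:R ->
  phi <= expR (u * s%:R / (N%:R - 4 * u)).
Proof.
move=> uN; apply: (le_trans laplace_le_log_derivative); rewrite ler_expR.
rewrite ler_pdivlMr ?subr_gt0 // mulrA mulrAC ler_pdivrMr ?laplace_gt0 //.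
exact: laplace_differential_inequality.
Qed.

End LaplaceTransform.

(** * Products of independent factors *)

(** The number of natural numbers below [y] is [y] rounded up. *)
Lemma layer_count_bounds {R : realType} (n : nat) (y : R) : 0 <= y -> y <= n%:R ->
  let h := \sum_(j < n) (j%:R < y)%R%:R in h - 1 <= y <= h.
Proof.
move=> y0; elim: n => [|n IHn] yn.
  by rewrite big_ord0 /=; lra.
rewrite big_ord_recr /=; have [ny|yn'] := ltP n%:R y.
  rewrite (eq_bigr (fun=> 1)) => [|j _]; last first.
    by rewrite (lt_trans _ ny) // ltr_nat.
  rewrite sumr_const card_ord; rewrite -natr1 in yn.
  by rewrite ltW //= ?andbT; lra.
by rewrite addr0; exact: IHn.
Qed.

Section Independence.
Context {d : measure_display} {T : measurableType d} {R : realType}.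
Variable P : probability T R.
Context {d' : measure_display} {T' : measurableType d'}.

Lemma mean_indic (A : set T) : measurable A -> \int[P]_w \1_A w = fine (P A).
Proof. by move=> mA; rewrite /Rintegral integral_indic // setIT. Qed.

Lemma bounded_rv_indic (A : set T) : measurable A -> bounded_rv (\1_A : T -> R).
Proof.
move=> mA; split; first exact: measurable_indic.
by exists 1 => w; rewrite indicE; case: (_ \in _); rewrite ?normr1 ?normr0.
Qed.

Lemma indic_comp (X : T -> T') (B : set T') w :
  \1_B (X w) = \1_(X @^-1` B) w :> R.
Proof. by rewrite !indicE; congr (_%:R); apply/idP/idP; rewrite !inE. Qed.

(** A bounded function is uniformly close to a multiple of the sum of the
    indicators of its level sets, so an identity known for indicators passes to
    it by linearity. *)
Lemma mean_mul_extend (X : T -> T') (G : T -> R) (c C : R) (f : T' -> R) :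
  measurable_fun setT X -> bounded_rv G ->
  (forall B, measurable B ->
     \int[P]_w (\1_B (X w) * G w) = (\int[P]_w \1_B (X w)) * c) ->
  measurable_fun setT f -> (forall y, 0 <= f y <= C) ->
  \int[P]_w (f (X w) * G w) = (\int[P]_w f (X w)) * c.
Proof.
move=> mX bG HB mf fC.
have bf : bounded_rv (fun w => f (X w)).
  split; first exact: measurableT_comp mf mX.
  by exists C => w; have /andP[f0 ?] := fC (X w); rewrite ger0_norm.
have [D G_le] : exists D, forall w, `|G w| <= D by case: bG.
have D0 : 0 <= D by apply: le_trans (normr_ge0 _) (G_le point).
pose C1 := `|C| + 1; have C1_gt0 : 0 < C1 by rewrite ltr_wpDl.
(* [F] below is [f] rounded up to a multiple of [C1 / n.+1] *)
have step n : `|\int[P]_w (f (X w) * G w) - (\int[P]_w f (X w)) * c|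
    <= (D + `|c|) * C1 / n.+1%:R.
  pose h := C1 / n.+1%:R.
  have h0 : 0 < h by rewrite divr_gt0.
  pose B (j : 'I_n.+1) := [set y | j%:R * h < f y].
  have mB j : measurable (B j).
    have -> : B j = [set: T'] `&` f @^-1` `](j%:R * h), +oo[.
      by rewrite setTI; apply/seteqP; split => y /=; rewrite in_itv /= andbT.
    exact: mf.
  have mXB j : measurable (X @^-1` B j).
    by rewrite -[X in measurable X]setTI; exact: mX.
  pose F w := h * \sum_(j < n.+1) \1_(B j) (X w).
  have b1 j : bounded_rv (fun w => \1_(B j) (X w) : R).
    rewrite (_ : (fun _ => _) = \1_(X @^-1` B j)); first exact: bounded_rv_indic.
    by apply/funext => w; exact: indic_comp.
  have bF : bounded_rv F by apply: bounded_rvZ; exact: bounded_rv_sum.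
  have FG : \int[P]_w (F w * G w) = (\int[P]_w F w) * c.
    transitivity (\int[P]_w (h * \sum_(j < n.+1) \1_(B j) (X w) * G w)).
      by apply: eq_Rintegral => w _; rewrite /F -mulrA mulr_suml.
    rewrite meanZ; last by apply: bounded_rv_sum => j; exact: bounded_rvM.
    rewrite mean_sum => [|j]; last exact: bounded_rvM.
    rewrite /F meanZ; last exact: bounded_rv_sum.
    rewrite mean_sum // -[RHS]mulrA mulr_suml.
    by congr (_ * _); apply: eq_bigr => j _; exact: HB.
  have close w : `|f (X w) - F w| <= h.
    have /andP[f0 f1] := fC (X w).
    have := @layer_count_bounds R n.+1 (f (X w) / h).
    have -> : f (X w) / h <= n.+1%:R.
      rewrite ler_pdivrMr // /h mulrC divfK ?pnatr_eq0 //.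
      by have := ler_norm C; rewrite /C1; lra.
    rewrite divr_ge0 // ?(ltW h0) // => /(_ isT isT) /=.
    rewrite (eq_bigr (fun j => \1_(B j) (X w))) => [|j _]; last first.
      rewrite indicE ltr_pdivlMr //.
      have -> // : (X w \in B j) = (j%:R * h < f (X w)).
      by apply/idP/idP; rewrite inE.
    rewrite ler_pdivlMr // ler_pdivrMr // => /andP[h1 h2].
    by rewrite ler_norml; apply/andP; split; rewrite /F /=; lra.
  have -> : \int[P]_w (f (X w) * G w) - (\int[P]_w f (X w)) * c =
     \int[P]_w ((f (X w) - F w) * G w) - (\int[P]_w (f (X w) - F w)) * c.
    under [X in _ = X - _]eq_Rintegral do rewrite mulrBl.
    rewrite meanB //; [|exact: bounded_rvM..].
    by rewrite meanB // FG; ring.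
  have norm_mean (g : T -> R) e : bounded_rv g -> (forall w, `|g w| <= e) ->
      `|\int[P]_w g w| <= e.
    move=> bg ge; rewrite ler_norml -(mean_cst P (- e)) -{2}(mean_cst P e).
    by apply/andP; split; apply: mean_le => //; first [exact: bounded_rv_cst |
      move=> w; have := ge w; rewrite ler_norml => /andP[]].
  apply: le_trans (ler_normB _ _) _.
  rewrite normrM -mulrA -/h mulrDl lerD //.
    apply: norm_mean => [|w].
      by apply: bounded_rvM => //; exact: bounded_rvB.
    by rewrite normrM mulrC ler_pM.
  rewrite mulrC ler_wpM2l //; apply: norm_mean => //.
  exact: bounded_rvB.
apply/eqP; rewrite -subr_eq0 -normr_le0; apply/ler_addgt0Pr => e e0.
rewrite add0r; set K := (D + `|c|) * C1 in step.
have [n Hn] : exists n : nat, K / e < n.+1%:R.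
  by exists (Num.truncn (K / e)); exact: truncnS_gt.
apply: (le_trans (step n)); rewrite ler_pdivrMr // mulrC -ler_pdivrMr //.
exact: ltW.
Qed.

Lemma bounded_rv_prod (I : Type) (r : seq I) (Q : pred I) (F : I -> T -> R) :
  (forall i, bounded_rv (F i)) ->
  bounded_rv (fun w => \prod_(i <- r | Q i) F i w).
Proof.
move=> bF; elim: r => [|i r IHr].
  rewrite (_ : (fun _ => _) = fun=> 1); first exact: bounded_rv_cst.
  by apply/funext => w; rewrite big_nil.
have [Qi|Qi] := boolP (Q i).
  rewrite (_ : (fun _ => _) = fun w => F i w * \prod_(j <- r | Q j) F j w).
    exact: bounded_rvM.
  by apply/funext => w; rewrite big_cons Qi.
rewrite (_ : (fun _ => _) = fun w => \prod_(j <- r | Q j) F j w) //.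
by apply/funext => w; rewrite big_cons (negbTE Qi).
Qed.

Lemma mean_prod_indic (I : finType) (X : I -> {RV P >-> T'}) (B : I -> set T') :
  independent_RVs X -> (forall i, measurable (B i)) ->
  \int[P]_w (\prod_i \1_(B i) (X i w)) = \prod_i \int[P]_w \1_(B i) (X i w).
Proof.
move=> indX mB.
have mX i : measurable (X i @^-1` B i).
  by rewrite -[X in measurable X]setTI; apply: measurable_funPT.
have E i : \int[P]_w \1_(B i) (X i w) = fine (P (X i @^-1` B i)).
  by rewrite -mean_indic //; apply: eq_Rintegral => w _; exact: indic_comp.
rewrite (eq_bigr _ (fun i _ => E i)).
have := indX [set: I]%SET B mB.
set A := \bigcap_(i in _) _ => PA.
have mA : measurable A by apply: fin_bigcap_measurable.
transitivity (fine (P A)).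
  rewrite -mean_indic //; apply: eq_Rintegral => w _.
  rewrite indicE; have [wA|wA] := boolP (w \in A).
    rewrite big1 // => i _; rewrite indicE mem_set //.
    by move/set_mem: wA => /(_ i); apply; exact: finset.in_setT.
  have [i wi] : exists i, ~ (X i @^-1` B i) w.
    apply/existsNP => H; move: wA; rewrite notin_setE; apply => i _.
    exact: H.
  by rewrite (bigD1 i) //= indicE memNset ?mul0r.
rewrite PA [X in fine X](_ : _ = (\prod_i fine (P (X i @^-1` B i)))%:E) //.
rewrite -prodEFin; apply: eq_big => [i|i _]; first exact: finset.in_setT.
by rewrite fineK // fin_num_measure.
Qed.

(** For indicators this is the definition of independence. The factors are
    turned from indicators into arbitrary functions one at a time, [J] being the
    set of the indices already treated. *)
Lemma mean_prod_indep (I : finType) (X : I -> {RV P >-> T'}) (h : I -> T' -> R)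
    (C : R) :
  independent_RVs X -> 1 <= C -> (forall i, measurable_fun setT (h i)) ->
  (forall i y, 0 <= h i y <= C) ->
  \int[P]_w (\prod_i h i (X i w)) = \prod_i \int[P]_w h i (X i w).
Proof.
move=> indX C1.
have mX i : measurable_fun setT (X i) by exact: measurable_funPT.
have brv (g : T' -> R) i : measurable_fun setT g ->
    (forall y, 0 <= g y <= C) -> bounded_rv (fun w => g (X i w)).
  move=> mg gC; split; first exact: measurableT_comp mg (mX i).
  by exists C => w; have /andP[g0 ?] := gC (X i w); rewrite ger0_norm.
suff H (n : nat) (J : {set I}) (g : I -> T' -> R) : #|J| = n ->
    (forall i, measurable_fun setT (g i)) -> (forall i y, 0 <= g i y <= C) ->
    (forall i, i \notin J -> exists2 B, measurable B & g i = \1_B) ->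
    \int[P]_w (\prod_i g i (X i w)) = \prod_i \int[P]_w g i (X i w).
  by move=> mh hC; apply: (H _ [set: I]%SET) => // i; rewrite inE.
elim: n J g => [|n IHn] J g.
  move=> /eqP; rewrite cards_eq0 => /eqP -> _ _ gB.
  have /choice[B HB] : forall i, exists B, measurable B /\ g i = \1_B.
    by move=> i; have [|B mB gE] := gB i; [rewrite inE | exists B].
  have gE i : g i = \1_(B i) by have [] := HB i.
  have mB i : measurable (B i) by have [] := HB i.
  have /funext -> : g =1 (fun i => \1_(B i)) by move=> i; rewrite gE.
  exact: mean_prod_indic.
move=> Jn mg gC gB.
have /card_gt0P[j jJ] : (0 < #|J|)%N by rewrite Jn.
transitivity (\int[P]_w (g j (X j w) * \prod_(i | i != j) g i (X i w))).
  by apply: eq_Rintegral => w _; rewrite (bigD1 j).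
rewrite (bigD1 j) //=; apply: (mean_mul_extend (C := C)) => //.
  by apply: bounded_rv_prod => i; exact: brv.
move=> B mB.
pose g' i := if i == j then \1_B else g i.
have g'j : g' j = \1_B by rewrite /g' eqxx.
have g'i i : i != j -> g' i = g i by rewrite /g' => /negbTE ->.
have IH : \int[P]_w (\prod_i g' i (X i w)) = \prod_i \int[P]_w g' i (X i w).
  apply: (IHn (J :\ j)).
  - by have := cardsD1 j J; rewrite jJ Jn add1n => -[].
  - move=> i; have [->|/g'i -> //] := eqVneq i j.
    by rewrite g'j; exact: measurable_indic.
  - move=> i y; have [->|/g'i -> //] := eqVneq i j.
    by rewrite g'j indicE; case: (_ \in _); rewrite ?ler01 ?lexx ?(le_trans _ C1).
  - move=> i; have [->|ij] := eqVneq i j; first by exists B; rewrite ?g'j.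
    by rewrite !inE ij /= => /gB; rewrite g'i.
transitivity (\int[P]_w (\prod_i g' i (X i w))).
  apply: eq_Rintegral => w _; rewrite [RHS](bigD1 j) //= g'j; congr (_ * _).
  by apply: eq_bigr => i /g'i ->.
rewrite IH (bigD1 j) //= g'j; congr (_ * _).
by apply: eq_bigr => i /g'i ->.
Qed.

End Independence.

(** * Rounding to the integer lattice *)

Section Rounding.
Context {R : realType} {N : nat}.
Implicit Types (y z : 'rV[R]_N).

Definition int_vec (k : 'I_N -> int) : 'rV[R]_N := \row_i (k i)%:~R.

(** Round the coordinates one after the other. As a function of one coordinate
    [F] is a quadratic polynomial of leading coefficient [c i], so with [th] the
    fractional part, [1 - th] times its value at the floor plus [th] times its
    value at the ceiling exceeds the current value by
    [th * (1 - th) * c i <= D i / 4]: one of the two roundings is no worse. *)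
Lemma quadratic_rounding (F : 'rV[R]_N -> R) (c D : 'I_N -> R) :
  (forall y i, exists b, forall t,
     F (y + t *: basis_vec i) = F y + 2 * t * b + t ^+ 2 * c i) ->
  (forall i, c i <= D i) -> (forall i, 0 <= D i) ->
  forall z, exists k : 'I_N -> int,
    (forall i, (`|k i|%N)%:R <= `|z 0 i| + 1) /\
    F (int_vec k) <= F z + (\sum_i D i) / 4.
Proof.
move=> FE cD D0 z.
(* the coordinates in [l] are rounded, the other ones are still those of [z] *)
have step (l : seq 'I_N) : uniq l -> exists k : 'I_N -> int,
    (forall i, (`|k i|%N)%:R <= `|z 0 i| + 1) /\
    F (\row_i (if i \in l then (k i)%:~R else z 0 i))
      <= F z + (\sum_(i <- l) D i) / 4.
  elim: l => [_|j l IHl /= /andP[jl ul]].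
    exists (fun=> 0); split=> [i|].
      by rewrite absz0; have := normr_ge0 (z 0 i); lra.
    rewrite big_nil mul0r addr0 (_ : \row__ _ = z) //.
    by apply/rowP => i; rewrite mxE.
  have [k [kb kF]] := IHl ul; set y := \row__ _ in kF.
  have [b yE] := FE y j.
  pose m := Num.floor (z 0 j); pose th := z 0 j - m%:~R.
  have th0 : 0 <= th by rewrite subr_ge0 floor_le_tmp.
  have th1 : th < 1 by rewrite ltrBlDl -[1]/(1%:~R) -intrD floorD1_gt.
  have yj : y 0 j = z 0 j by rewrite mxE (negbTE jl).
  pose kk v i := if i == j then v else k i.
  have E v : \row_i (if i \in j :: l then (kk v i)%:~R else z 0 i)
      = y + (v%:~R - z 0 j) *: basis_vec j.
    apply/rowP => i; rewrite !mxE in_cons /kk eqxx /=.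
    have [->|ij] := eqVneq i j; last by rewrite mulr0 addr0.
    by rewrite (negbTE jl) mulr1 addrC subrK.
  have kkb v : (`|v|%N)%:R <= `|z 0 j| + 1 ->
      forall i, (`|kk v i|%N)%:R <= `|z 0 i| + 1.
    by move=> vb i; rewrite /kk; have [->|] := eqVneq i j.
  have absE v : (`|v|%N)%:R = `|v%:~R : R| by rewrite natr_absz intr_norm.
  suff [v [vb vF]] : exists v, (`|v|%N)%:R <= `|z 0 j| + 1 /\
      F (y + (v%:~R - z 0 j) *: basis_vec j) <= F y + D j / 4.
    exists (kk v); split; first exact: kkb.
    by rewrite E big_cons; lra.
  have ab0 := ler_norm (z 0 j); have := ler_norm (- z 0 j); rewrite normrN => ab1.
  have thth : th * (1 - th) * c j <= D j / 4.
    have q0 : 0 <= th * (1 - th) by rewrite mulr_ge0 // subr_ge0 ltW.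
    have q1 : th * (1 - th) <= 1 / 4.
      by rewrite -subr_ge0 (_ : _ - _ = (th - 1 / 2) ^+ 2) ?sqr_ge0 //; field.
    apply: le_trans (ler_wpM2l q0 (cD j)) _.
    by apply: le_trans (ler_wpM2r (D0 j) q1) _; lra.
  have F0 : F (y + (m%:~R - z 0 j) *: basis_vec j)
      = F y - 2 * th * b + th ^+ 2 * c j.
    by rewrite yE -/th (_ : m%:~R - z 0 j = - th); [ring | rewrite /th; ring].
  have F1 : F (y + ((m + 1)%:~R - z 0 j) *: basis_vec j)
      = F y + 2 * (1 - th) * b + (1 - th) ^+ 2 * c j.
    by rewrite yE intrD (_ : _ - _ = 1 - th) //; rewrite /th; ring.
  have mz : m%:~R = z 0 j - th by rewrite /th; ring.
  have [h|h] := leP (F (y + (m%:~R - z 0 j) *: basis_vec j)) (F y + D j / 4).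
    exists m; split=> //; rewrite absE mz ler_norml; apply/andP; split; lra.
  exists (m + 1); split.
    rewrite absE intrD mz ler_norml; apply/andP; split; lra.
  rewrite F1; move: h; rewrite F0 => h; nra.
have [k [kb kF]] := step (index_enum 'I_N) (index_enum_uniq _).
exists k; split=> //; rewrite (_ : int_vec k = \row_i
  (if i \in index_enum 'I_N then (k i)%:~R else z 0 i)) //.
by apply/rowP => i; rewrite !mxE mem_index_enum.
Qed.

End Rounding.

(** * Frame bounds from lattice points *)

Section FrameForm.
Context {R : realType} {N K : nat}.
Variable W : 'I_K -> {vspace 'rV[R]_N}.
Implicit Types (x y z : 'rV[R]_N).

Definition frame_quad x := \sum_k dot (orthproj (W k) x) x.

Lemma frame_quad_ge0 x : 0 <= frame_quad x.
Proof. by apply: sumr_ge0 => k _; exact: orthproj_ge0. Qed.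

Lemma frame_quadZ a x : frame_quad (a *: x) = a ^+ 2 * frame_quad x.
Proof.
rewrite /frame_quad mulr_sumr; apply: eq_bigr => k _.
by rewrite linearZ /= dotZl dotZr mulrA.
Qed.

Lemma frame_quad_trace :
  \sum_i frame_quad (basis_vec i) = (\sum_k \dim (W k))%:R.
Proof.
rewrite exchange_big natr_sum; apply: eq_bigr => k _; exact: trace_orthproj.
Qed.

Lemma pencil_expansion (al be : R) y i : exists b, forall t,
  let F z := al * dot z z + be * frame_quad z in
  F (y + t *: basis_vec i) =
  F y + 2 * t * b + t ^+ 2 * (al + be * frame_quad (basis_vec i)).
Proof.
exists (al * dot y (basis_vec i)
        + be * \sum_k dot (orthproj (W k) y) (basis_vec i)) => t /=.
have -> : frame_quad (y + t *: basis_vec i) = frame_quad y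
    + 2 * t * (\sum_k dot (orthproj (W k) y) (basis_vec i))
    + t ^+ 2 * frame_quad (basis_vec i).
  rewrite /frame_quad !mulr_sumr -!big_split; apply: eq_bigr => k _ /=.
  rewrite linearD linearZ /= !(dotDl, dotDr, dotZl, dotZr).
  by rewrite (dot_orthprojC (W k) (basis_vec i) y); ring.
rewrite !(dotDl, dotDr, dotZl, dotZr) (dotC (basis_vec i) y).
by rewrite dot_basis eqxx mulr1; ring.
Qed.

(** Blow [x] up to the sphere of radius [nu * Num.sqrt N] and round it to a
    lattice point. The rounding error [S * N%:R / 4] does not depend on the
    radius, so scaling back to a unit vector divides it by [nu ^+ 2 * N%:R]. The
    point reached has l1 norm at most [(nu + 1) * N%:R]: the vector before
    rounding has l1 norm at most [nu * N%:R] by the inequality between the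
    arithmetic and the geometric mean. *)
Lemma pencil_lower_bound (al be S nu : R) (D : 'I_N -> R) : 0 < nu ->
  (forall i, al + be * frame_quad (basis_vec i) <= D i) ->
  (forall i, 0 <= D i) -> \sum_i D i = S * N%:R ->
  (forall k : 'I_N -> int, (\sum_i `|k i|%N)%:R <= (nu + 1) * N%:R ->
     0 <= al * dot (int_vec k) (int_vec k) + be * frame_quad (int_vec k)) ->
  forall x, 0 <= al * dot x x + be * frame_quad x + nu ^- 2 * (S / 4 * dot x x).
Proof.
move=> nu0 cD D0 SD Hk x; have [->|x0] := eqVneq x 0.
  have -> : frame_quad 0 = 0.
    by rewrite /frame_quad big1 // => k _; rewrite linear0 dot0l.
  by rewrite dot0l !mulr0 !addr0.
have xx := dot_pos x0.
have N0 : 0 < N%:R :> R.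
  rewrite ltr0n lt0n; apply/eqP => N0; move: xx.
  by rewrite /dot big1 ?ltxx // => i; by have := ltn_ord i; rewrite {2}N0.
pose la := Num.sqrt (nu ^+ 2 * N%:R / dot x x).
have la2 : la ^+ 2 = nu ^+ 2 * N%:R / dot x x.
  by rewrite sqr_sqrtr // divr_ge0 ?mulr_ge0 ?sqr_ge0 // ltW.
pose z := la *: x.
have zz : dot z z = nu ^+ 2 * N%:R.
  by rewrite dotZl dotZr mulrA -expr2 la2 divfK // gt_eqF.
have [k [kb kF]] := quadratic_rounding (pencil_expansion al be) cD D0 z.
have kl1 : (\sum_i `|k i|%N)%:R <= (nu + 1) * N%:R.
  rewrite natr_sum; apply: (@le_trans _ _
    (\sum_(i < N) ((z 0 i * z 0 i / nu + nu) / 2 + 1))).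
    (* [`|z 0 i|] is at most the mean of [z 0 i ^+ 2 / nu] and [nu] *)
    apply: ler_sum => i _; apply: le_trans (kb i) _; rewrite lerD2r.
    rewrite -subr_ge0 (_ : _ - _ = (`|z 0 i| - nu) ^+ 2 / nu / 2).
      by rewrite !divr_ge0 ?sqr_ge0 // ltW.
    rewrite (_ : z 0 i * z 0 i = `|z 0 i| ^+ 2); last first.
      by rewrite real_normK ?num_real.
    by field; exact: lt0r_neq0.
  rewrite big_split /= -mulr_suml big_split /= -mulr_suml -/(dot z z) zz.
  rewrite !sumr_const card_ord -[nu *+ N]mulr_natr.
  by rewrite le_eqVlt; apply/orP; left; apply/eqP; field; exact: lt0r_neq0.
have := Hk k kl1; move: kF; rewrite SD zz /z frame_quadZ => kF k0.
have {kF k0} : 0 <= al * (nu ^+ 2 * N%:R) + be * (la ^+ 2 * frame_quad x)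
    + S * N%:R / 4.
  exact: le_trans k0 kF.
rewrite la2 => H.
have c0 : 0 < dot x x / (nu ^+ 2 * N%:R).
  by rewrite divr_gt0 // mulr_gt0 // exprn_gt0.
have := mulr_ge0 (ltW c0) H; congr (0 <= _); field.
by rewrite !lt0r_neq0.
Qed.

(** In the lower bound the rounding error involves the diagonal coefficients of
    the frame form only through their sum, which is the total dimension. *)
Lemma frame_bounds_of_lattice (a b nu : R) : 0 < nu -> 0 <= a -> 0 <= b ->
  (forall k : 'I_N -> int, (\sum_i `|k i|%N)%:R <= (nu + 1) * N%:R ->
     a * dot (int_vec k) (int_vec k) <= frame_quad (int_vec k)
       <= b * dot (int_vec k) (int_vec k)) ->
  (0 < N)%N -> forall x,
  (a - (\sum_k \dim (W k))%:R / N%:R * (nu ^- 2 / 4)) * dot x x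
    <= frame_quad x <= b * (1 + nu ^- 2 / 4) * dot x x.
Proof.
move=> nu0 a0 b0 Hk N0 x.
have N0' : N%:R != 0 :> R by rewrite pnatr_eq0 -lt0n.
set M : R := _%:R.
have lo : 0 <= - a * dot x x + 1 * frame_quad x
    + nu ^- 2 * ((M / N%:R) / 4 * dot x x).
  apply: (pencil_lower_bound (D := fun i => frame_quad (basis_vec i))) => //.
  - by move=> i; rewrite mul1r; lra.
  - by move=> i; exact: frame_quad_ge0.
  - by rewrite frame_quad_trace divfK.
  - by move=> k /Hk /andP[h _]; rewrite mul1r mulNr addrC subr_ge0.
have up : 0 <= b * dot x x + -1 * frame_quad x + nu ^- 2 * (b / 4 * dot x x).
  apply: (pencil_lower_bound (D := fun i => b)) => //.
  - by move=> i; have := frame_quad_ge0 (basis_vec i); lra.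
  - by rewrite sumr_const card_ord mulr_natr.
  - by move=> k /Hk /andP[_ h]; lra.
by apply/andP; split; lra.
Qed.

(** Bounds on the whole lattice carry over to all vectors by letting the radius
    [nu] of the previous lemma tend to infinity. *)
Lemma frame_bounds_int_vec (a b : R) : 0 <= a -> 0 <= b -> (0 < N)%N ->
  (forall k : 'I_N -> int,
     a * dot (int_vec k) (int_vec k) <= frame_quad (int_vec k)
       <= b * dot (int_vec k) (int_vec k)) ->
  forall x, a * dot x x <= frame_quad x <= b * dot x x.
Proof.
move=> a0 b0 N0 Hk x; set M : R := (\sum_k \dim (W k))%:R.
have H (t : R) : 0 < t -> (a - M / N%:R * (t / 4)) * dot x x
    <= frame_quad x <= b * (1 + t / 4) * dot x x.
  move=> t0; pose nu := (Num.sqrt t)^-1.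
  have nu2 : nu ^- 2 = t by rewrite exprVn invrK sqr_sqrtr // ltW.
  have nu0 : 0 < nu by rewrite invr_gt0 sqrtr_gt0.
  by rewrite -nu2; apply: frame_bounds_of_lattice => // k _; exact: Hk.
have xx := dot_ge0 x.
apply/andP; split; rewrite -subr_ge0.
  apply: (@ge0_of_small_perturbation R 1 _ (M / N%:R / 4 * dot x x)) => //.
    by rewrite !mulr_ge0 ?invr_ge0.
  by move=> t t0 _; have /andP[h _] := H t t0; lra.
apply: (@ge0_of_small_perturbation R 1 _ (b / 4 * dot x x)) => //.
  by rewrite !mulr_ge0 ?invr_ge0.
by move=> t t0 _; have /andP[_ h] := H t t0; lra.
Qed.

End FrameForm.

(** * Concentration at one vector *)

Section Concentration.
Context {d : measure_display} {T : measurableType d} {R : realType}.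
Context {P : probability T R} {N K : nat} {s_ : 'I_K -> nat}.
Variable V : 'I_K -> {RV P >-> subspaces R N}.
Hypothesis N_gt0 : (0 < N)%N.
Hypothesis V_indep : independent_RVs V.
Hypothesis V_inv : forall k, unitarily_invariant (V k).
Hypothesis V_dim : forall k w, \dim (V k w : {vspace 'rV[R]_N}) = s_ k.
Implicit Types x : 'rV[R]_N.

Let M : R := (\sum_(k < K) s_ k)%:R.

Definition frame_form x w := frame_quad (fun k => V k w) x.

Lemma bounded_frame_form x : bounded_rv (frame_form x).
Proof. by apply: bounded_rv_sum => k; exact: bounded_proj_coef. Qed.

(** Independence multiplies the bounds for the single subspaces; in the exponent
    the dimensions add up. *)
Lemma laplace_frame_form (u : R) x : dot x x = 1 -> 4 * u < N%:R ->
  \int[P]_w expR (u * frame_form x w) <= expR (u * M / (N%:R - 4 * u)).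
Proof.
move=> x1 uN.
pose h (k : 'I_K) (W : subspaces R N) := expR (u * dot (orthproj W x) x).
have -> : \int[P]_w expR (u * frame_form x w) =
    \int[P]_w (\prod_k h k (V k w)).
  by apply: eq_Rintegral => w _; rewrite /frame_form mulr_sumr expR_sum.
have u0 := normr_ge0 u.
rewrite (mean_prod_indep (C := expR `|u|)) //; first last.
- move=> k W; rewrite expR_ge0 ler_expR /=.
  have := orthproj_ge0 W x; have := orthproj_le W x; rewrite x1.
  by have := ler_norm u; nra.
- move=> k; apply: measurableT_comp; first exact: measurable_expR.
  by apply: measurable_funM => //; exact: measurable_dot_orthproj.
- by rewrite -expR0 ler_expR.
pose i0 := Ordinal N_gt0.
have le_k k : \int[P]_w h k (V k w) <= expR (u * (s_ k)%:R / (N%:R - 4 * u)).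
  rewrite /h (@laplace_invariant _ _ _ _ _ (V k) (V_inv k) u x (basis_vec i0)).
    exact: laplace_bound.
  by rewrite x1 dot_basis eqxx.
apply: (@le_trans _ _ (\prod_(k < K) expR (u * (s_ k)%:R / (N%:R - 4 * u)))).
  apply: ler_prod => k _; rewrite le_k andbT.
  by apply: Rintegral_ge0 => w _; exact: expR_ge0.
by rewrite -expR_sum -mulr_suml -mulr_sumr -natr_sum.
Qed.

(** Markov's inequality for [expR (u * frame_form x)]; [u] may have either sign. *)
Lemma chernoff_frame_form (u theta : R) x (A : set T) : dot x x = 1 -> 4 * u < N%:R ->
  measurable A -> (forall w, A w -> u * theta <= u * frame_form x w) ->
  fine (P A) <= expR (u * M / (N%:R - 4 * u) - u * theta).
Proof.
move=> x1 uN mA HA.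
have bE : bounded_rv (fun w => expR (u * frame_form x w)).
  by apply: bounded_rv_expR; apply: bounded_rvZ; exact: bounded_frame_form.
rewrite -mean_indic // expRD.
apply: le_trans
  (_ : _ <= \int[P]_w (expR (- (u * theta)) * expR (u * frame_form x w))) _.
  apply: mean_le => [||w]; [exact: bounded_rv_indic | exact: bounded_rvZ |].
  rewrite indicE -expRD.
  have [/set_mem Aw|_] := boolP (w \in A); last exact: expR_ge0.
  by rewrite /= -[true%:R]expR0 ler_expR addrC subr_ge0; exact: HA.
rewrite meanZ // mulrC ler_pM2r ?expR_gt0 //.
exact: laplace_frame_form.
Qed.

(** The parameter [u] minimizes the exponent of the Chernoff bound; it makes
    [N%:R - 4 * u] equal to [N%:R / rho]. *)
Lemma upper_tail (rho : R) x (A : set T) : 1 < rho -> dot x x = 1 -> measurable A ->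
  (forall w, A w -> rho ^+ 2 * M / N%:R <= frame_form x w) ->
  fine (P A) <= expR (- (M * ((rho - 1) ^+ 2 / 4))).
Proof.
move=> rho1 x1 mA HA.
have N0 : 0 < N%:R :> R by rewrite ltr0n.
have r0 : 0 < rho by lra.
pose u : R := N%:R * (1 - rho^-1) / 4.
have i1 : rho^-1 < 1 by rewrite invf_lt1.
have u0 : 0 < u by rewrite /u divr_gt0 // mulr_gt0 // subr_gt0.
have Nu : N%:R - 4 * u = N%:R / rho by rewrite /u; field; rewrite gt_eqF.
have uN : 4 * u < N%:R by rewrite -subr_gt0 Nu divr_gt0.
have := chernoff_frame_form x1 uN mA (theta := rho ^+ 2 * M / N%:R).
rewrite Nu (_ : _ - _ = - (M * ((rho - 1) ^+ 2 / 4))); last first.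
  by rewrite /u; field; rewrite !gt_eqF.
by apply => w /HA; rewrite ler_pM2l.
Qed.

(** Here the optimal [u] is negative and makes [N%:R - 4 * u] equal to
    [N%:R * rho]. *)
Lemma lower_tail (rho : R) x (A : set T) : 1 < rho -> dot x x = 1 -> measurable A ->
  (forall w, A w -> frame_form x w <= M / (N%:R * rho ^+ 2)) ->
  fine (P A) <= expR (- (M * ((rho - 1) ^+ 2 / (4 * rho ^+ 2)))).
Proof.
move=> rho1 x1 mA HA.
have N0 : 0 < N%:R :> R by rewrite ltr0n.
have r0 : 0 < rho by lra.
pose u : R := N%:R * (1 - rho) / 4.
have u0 : u < 0 by rewrite /u; nra.
have Nu : N%:R - 4 * u = N%:R * rho by rewrite /u; field.
have uN : 4 * u < N%:R by rewrite -subr_gt0 Nu mulr_gt0.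
have := chernoff_frame_form x1 uN mA (theta := M / (N%:R * rho ^+ 2)).
rewrite Nu (_ : _ - _ = - (M * ((rho - 1) ^+ 2 / (4 * rho ^+ 2)))); last first.
  by rewrite /u; field; rewrite !gt_eqF.
by apply => w /HA; rewrite ler_nM2l.
Qed.

End Concentration.

(** * Lattice points in an l1 ball *)

Section Count.
Context {R : realType}.

Lemma expR1_le3 : expR 1 <= 3 :> R.
Proof.
have -> : 1 = 1 / 4 + 1 / 4 + (1 / 4 + 1 / 4) :> R by field.
rewrite !expRD; have := expR_gt0 (1 / 4 : R).
have h : 1 / 4 <= 1 / 3 :> R by lra.
have := expR_le_quadratic h; move: (expR _) => e e1 e0.
have e2 : e * e <= (21 / 16) * (21 / 16) by rewrite ler_pM //; lra.
apply: (@le_trans _ _ ((21 / 16) * (21 / 16) * ((21 / 16) * (21 / 16)))); last lra.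
by rewrite ler_pM // mulr_ge0 // ltW.
Qed.

Lemma geometric_sum_le (q : R) n : 0 <= q -> q < 1 ->
  \sum_(m < n) q ^+ m <= (1 - q)^-1.
Proof.
move=> q0 q1; have q1' : 0 < 1 - q by rewrite subr_gt0.
rewrite -[leRHS]mul1r ler_pdivlMr // mulrC.
have := subrX1 q n; have := exprn_ge0 n q0; lra.
Qed.

(** A code gives the sign and the absolute value of every coordinate of an
    integer vector, so that sums over codes are powers of geometric sums. A
    coordinate equal to [0] has two codes. *)
Definition l1_ball_codes (N L r : nat) : {set {ffun 'I_N -> bool * 'I_L.+1}} :=
  [set f : {ffun 'I_N -> bool * 'I_L.+1} | (\sum_i (f i).2 <= r)%N]%SET.

(** Give the vector [k] the weight [q ^+ (l1 norm of k)] with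
    [q = n.+1 / n.+2]. On the l1 ball the weight is at least
    [q ^+ (n.+1 * N)], hence at least [3 ^- N], while the total weight is the
    [N]-th power of a geometric sum which is at most [2 * n.+2]. *)
Lemma card_l1_ball_codes (N L n : nat) :
  #|l1_ball_codes N L (n.+1 * N)|%:R <= (6 * n%:R + 12) ^+ N :> R.
Proof.
pose q : R := n.+1%:R / n.+2%:R.
have q_gt0 : 0 < q by rewrite divr_gt0.
have q_lt1 : q < 1 by rewrite ltr_pdivrMr // mul1r ltr_nat.
have q_inv : q^-1 ^+ n.+1 <= 3.
  have -> : q^-1 = 1 + n.+1%:R^-1.
    by rewrite /q invf_div -[n.+2%:R]natr1; field.
  apply: (@le_trans _ _ (expR n.+1%:R^-1 ^+ n.+1)).
    by rewrite lerXn2r ?nnegrE ?expR_ge0 ?addr_ge0 ?invr_ge0 // expR_ge1Dx.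
  by rewrite -expRM_natl mulfV // expR1_le3.
have geo : \sum_(p : bool * 'I_L.+1) q ^+ p.2 <= 2 * n.+2%:R.
  rewrite -(pair_bigA _ (fun (b : bool) (m : 'I_L.+1) => q ^+ m)) /= big_bool /=.
  have := geometric_sum_le L.+1 (ltW q_gt0) q_lt1.
  have n2 : n.+2%:R != 0 :> R by rewrite pnatr_eq0.
  have -> : 1 - q = n.+2%:R^-1.
    apply: (mulIf n2); rewrite mulVf // mulrBl mul1r /q divfK //.
    by rewrite -[n.+2%:R]natr1; ring.
  by rewrite invrK; lra.
pose w : R := q^-1 ^+ (n.+1 * N).
have w0 : 0 <= w by rewrite exprn_ge0 // invr_ge0 ltW.
apply: (@le_trans _ _ (\sum_(f : {ffun 'I_N -> bool * 'I_L.+1})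
    w * \prod_i q ^+ (f i).2)).
  rewrite -sum1_card natr_sum big_mkcond /=; apply: ler_sum => f _.
  have p0 : 0 <= \prod_i q ^+ (f i).2.
    by apply: prodr_ge0 => i _; rewrite exprn_ge0 // ltW.
  case: ifP => [|_]; last exact: mulr_ge0.
  rewrite inE => fr; rewrite prodrXr /w exprVn mulrC.
  rewrite ler_pdivlMr ?exprn_gt0 // mul1r; apply: ler_wiXn2l => //; exact: ltW.
rewrite -mulr_sumr.
rewrite -(bigA_distr_bigA (fun (_ : 'I_N) (p : bool * 'I_L.+1) => q ^+ p.2)) /=.
rewrite prodr_const card_ord /w exprM -exprMn.
have s0 : 0 <= \sum_(p : bool * 'I_L.+1) q ^+ p.2.
  by apply: sumr_ge0 => p _; rewrite exprn_ge0 // ltW.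
have v0 : 0 <= q^-1 ^+ n.+1 by rewrite exprn_ge0 // invr_ge0 ltW.
have n0 := ler0n R n.
apply: lerXn2r; rewrite ?nnegrE; [exact: mulr_ge0 | lra |].
apply: le_trans (ler_pM v0 s0 q_inv geo) _.
by rewrite -[n.+2%:R]natr1 -[n.+1%:R]natr1; lra.
Qed.

End Count.

(** * Choice of the constants *)

Section Numerics.
Context {R : realType}.
Implicit Types (delta M : R).

(** The right-hand side is the rate of the lower tail at
    [rho = (1 + delta) ^+ 2]. For small [delta] it is about four times
    [delta ^+ 2 / 4 - delta ^+ 3 / 3]; twice this rate suffices, one half of it
    paying for the number of lattice points. *)
Lemma tail_rate_ge delta : 0 < delta -> delta < 3 / 4 ->
  delta ^+ 2 / 2 - 2 * delta ^+ 3 / 3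
    <= ((1 + delta) ^+ 2 - 1) ^+ 2 / (4 * ((1 + delta) ^+ 2) ^+ 2).
Proof.
move=> d0 d1.
have w0 : 0 < 4 * ((1 + delta) ^+ 2) ^+ 2.
  by rewrite mulr_gt0 // !exprn_gt0 //; lra.
rewrite ler_pdivlMr // -subr_ge0.
have -> : ((1 + delta) ^+ 2 - 1) ^+ 2
   - (delta ^+ 2 / 2 - 2 * delta ^+ 3 / 3) * (4 * ((1 + delta) ^+ 2) ^+ 2)
  = delta ^+ 2 * ((2 - 4 / 3 * delta - delta ^+ 2 / 3)
     + (8 * delta ^+ 3 + 26 / 3 * delta ^+ 4 + 8 / 3 * delta ^+ 5)) by field.
rewrite mulr_ge0 ?sqr_ge0 // addr_ge0 //; first by nra.
by rewrite !addr_ge0 // mulr_ge0 ?exprn_ge0 ?ltW.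
Qed.

Lemma upper_margin delta e : 0 < delta -> e <= delta ^+ 2 / 16 -> delta < 3 / 4 ->
  (1 + delta) ^+ 4 * (1 + e) <= (1 + delta) ^+ 6.
Proof.
move=> d0 he d1; rewrite [leRHS](exprD _ 4 2) ler_pM2l ?exprn_gt0 //; last lra.
nra.
Qed.

Lemma lower_margin delta e : 0 < delta -> e <= delta ^+ 2 / 16 -> delta < 3 / 4 ->
  (1 + delta) ^- 6 <= (1 + delta) ^- 4 - e.
Proof.
move=> d0 he d1.
have r0 : 0 < 1 + delta by lra.
have r6 : (1 + delta) ^+ 6 <= 32.
  have h : 1 + delta <= 7 / 4 by lra.
  apply: le_trans (_ : (7 / 4) ^+ 6 <= _).
    by rewrite lerXn2r ?nnegrE //; lra.
  lra.
rewrite -(ler_pM2l (exprn_gt0 6 r0)) mulrBr mulfV ?gt_eqF ?exprn_gt0 //.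
rewrite (exprD _ 2 4) -mulrA mulfV ?gt_eqF ?exprn_gt0 // mulr1 -(exprD _ 2 4).
have : (1 + delta) ^+ 6 * e <= 32 * (delta ^+ 2 / 16).
  apply: le_trans (ler_wpM2l (exprn_ge0 _ (ltW r0)) he) _.
  by rewrite ler_wpM2r // divr_ge0 ?sqr_ge0.
nra.
Qed.

(** The witness is the least integer exceeding [2 / delta]. *)
Lemma grid_parameter delta : 0 < delta -> delta < 3 / 4 -> exists n : nat,
  [/\ 0 < n%:R :> R, n%:R ^- 2 / 4 <= delta ^+ 2 / 16
    & 6 * n%:R + 12 <= (1 + 4 / delta) ^+ 2].
Proof.
move=> d0 d1; pose t := delta^-1.
have t0 : 4 / 3 <= t by rewrite /t -(ler_pM2r d0) mulVf ?gt_eqF //; lra.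
exists (Num.truncn (2 * t)).+1.
have n1 : 2 * t < (Num.truncn (2 * t)).+1%:R by exact: truncnS_gt.
have n2 : (Num.truncn (2 * t)).+1%:R <= 2 * t + 1.
  by rewrite -natr1 lerD2r truncn_le //; lra.
move: ((Num.truncn (2 * t)).+1%:R : R) n1 n2 => n n1 n2.
have n0 : 0 < n by lra.
split=> //; last first.
  by rewrite -/t; nra.
have -> : delta ^+ 2 / 16 = (2 * t) ^- 2 / 4 by rewrite /t; field; rewrite gt_eqF.
rewrite ler_pM2r ?invr_gt0 // lef_pV2 ?posrE ?exprn_gt0 //; last lra.
by rewrite lerXn2r ?nnegrE //; lra.
Qed.

End Numerics.

(** * Frame bounds for all vectors *)

Lemma union_bound {d : measure_display} {T : measurableType d} {R : realType}
    (P : probability T R) (I : finType) (A : {set I}) (B : I -> set T)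
    (E : set T) (beta : R) :
  measurable E -> (forall i, measurable (B i)) ->
  (forall w, (forall i, i \in A -> ~ B i w) -> E w) ->
  (forall i, i \in A -> fine (P (B i)) <= beta) ->
  1 - #|A|%:R * beta <= fine (P E).
Proof.
move=> mE mB BE Bbeta; rewrite -(mean_indic P mE).
apply: (@le_trans _ _ (\int[P]_w (1 - \sum_(i in A) \1_(B i) w))).
  rewrite meanB; [|exact: bounded_rv_cst|].
    rewrite mean_cst lerD2l lerN2 mean_sum.
      rewrite mulr_natl -sumr_const; apply: ler_sum => i iA.
      by rewrite mean_indic // Bbeta.
    by move=> i; exact: bounded_rv_indic.
  by apply: bounded_rv_sum => i; exact: bounded_rv_indic.
apply: mean_le => [||w].
- apply: bounded_rvB; first exact: bounded_rv_cst.
  by apply: bounded_rv_sum => i; exact: bounded_rv_indic.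
- exact: bounded_rv_indic.
have s0 (Q : pred I) : 0 <= \sum_(i | Q i) \1_(B i) w :> R.
  by apply: sumr_ge0 => i _; rewrite indicE.
have [Bw|/existsNP[i /not_implyP[iA /contrapT Bi]]] :=
  pselect (forall i, i \in A -> ~ B i w).
  rewrite [X in _ <= X]indicE mem_set; last exact: BE.
  by have := s0 (mem A); rewrite /= => h; lra.
rewrite (bigD1 i) //= [\1_(B i) w]indicE mem_set // opprD addrA subrr add0r.
by rewrite (@le_trans _ _ 0) ?oppr_le0 ?s0 //.
Qed.

Section FrameEvents.
Context {d : measure_display} {T : measurableType d} {R : realType}.
Context {P : probability T R} {N K : nat} {s_ : 'I_K -> nat}.
Variable V : 'I_K -> {RV P >-> subspaces R N}.
Hypothesis N_gt0 : (0 < N)%N.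

Lemma measurable_frame_form_itv x (a b : R) :
  measurable [set w | a <= frame_form V x w <= b].
Proof.
have [mf _] := bounded_frame_form V x.
rewrite (_ : [set _ | _] = [set: T] `&` frame_form V x @^-1` `[a, b]).
  exact: mf.
by rewrite setTI; apply/seteqP; split => w /=; rewrite in_itv.
Qed.

(** Integer vectors suffice to test frame bounds, and there are countably many. *)
Lemma measurable_frame_event (a b : R) : 0 <= a -> 0 <= b ->
  measurable [set w | forall x,
    a * dot x x <= frame_quad (fun k => V k w) x <= b * dot x x].
Proof.
move=> a0 b0.
pose F (n : nat) : set T :=
  if unpickle n is Some k then
    let x := int_vec (k : {ffun 'I_N -> int}) in
    [set w | a * dot x x <= frame_form V x w <= b * dot x x]
  else setT.
rewrite (_ : [set _ | _] = \bigcap_n F n).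
  apply: bigcapT_measurable => n; rewrite /F.
  by case: unpickle => [k|//]; exact: measurable_frame_form_itv.
apply/seteqP; split => w /= H.
  by move=> n _; rewrite /F; case: unpickle => [k|//]; exact: H.
apply: frame_bounds_int_vec => // k.
have := H (pickle [ffun i => k i]) I; rewrite /F pickleK /=.
rewrite (_ : int_vec _ = int_vec k) //.
by apply/rowP => i; rewrite !mxE ffunE.
Qed.

Hypothesis V_indep : independent_RVs V.
Hypothesis V_inv : forall k, unitarily_invariant (V k).
Hypothesis V_dim : forall k w, \dim (V k w : {vspace 'rV[R]_N}) = s_ k.

Let M : R := (\sum_(k < K) s_ k)%:R.

(** Both sides of the frame inequality are homogeneous of degree 2, so [x] may be
    taken of norm [1]. *)
Lemma vector_tail (rho : R) x : 1 < rho ->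
  fine (P (~` [set w | M / (N%:R * rho ^+ 2) * dot x x <= frame_form V x w
                      <= rho ^+ 2 * M / N%:R * dot x x]))
  <= 2 * expR (- (M * ((rho - 1) ^+ 2 / (4 * rho ^+ 2)))).
Proof.
move=> rho1; have [->|x0] := eqVneq x 0.
  rewrite (_ : ~` _ = set0) ?measure0 ?mulr_ge0 ?expR_ge0 //.
  apply/seteqP; split => w //=; apply; rewrite dot0l !mulr0.
  rewrite /frame_form /frame_quad big1 ?lexx // => k _.
  by rewrite linear0 dot0l.
have xx := dot_pos x0.
pose c := (Num.sqrt (dot x x))^-1; pose y := c *: x.
have c2 : c ^+ 2 = (dot x x)^-1 by rewrite exprVn sqr_sqrtr // ltW.
have y1 : dot y y = 1 by rewrite dotZl dotZr mulrA -expr2 c2 mulVf // gt_eqF.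
have xE w : frame_form V x w = frame_form V y w * dot x x.
  by rewrite /frame_form frame_quadZ c2 mulrAC mulVf ?mul1r // gt_eqF.
set a := M / _; set b := _ * M / _.
pose U := ~` [set w | frame_form V y w <= b].
pose L := ~` [set w | a <= frame_form V y w].
have [mf _] := bounded_frame_form V y.
have mU : measurable U.
  apply: measurableC; rewrite -[X in measurable X]setTI.
  rewrite (_ : [set _ | _] = frame_form V y @^-1` `]-oo, b]); first exact: mf.
  by apply/seteqP; split => w /=; rewrite in_itv.
have mL : measurable L.
  apply: measurableC; rewrite -[X in measurable X]setTI.
  rewrite (_ : [set _ | _] = frame_form V y @^-1` `[a, +oo[); first exact: mf.
  by apply/seteqP; split => w /=; rewrite in_itv /= andbT.
have -> : ~` [set w | a * dot x x <= frame_form V x w <= b * dot x x] = L `|` U.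
  rewrite /L /U -setCI; congr (~` _).
  apply/seteqP; split => w /=; rewrite xE !ler_pM2r //.
    by move=> /andP[].
  by case=> -> ->.
have PU : fine (P U) <= expR (- (M * ((rho - 1) ^+ 2 / (4 * rho ^+ 2)))).
  apply: le_trans (upper_tail N_gt0 V_indep V_inv V_dim rho1 y1 mU _) _.
    by move=> w /negP; rewrite -ltNge => /ltW.
  rewrite ler_expR lerN2 ler_wpM2l //.
  rewrite ler_wpM2l ?sqr_ge0 // lef_pV2 ?posrE ?mulr_gt0 ?exprn_gt0 //; try lra.
  by rewrite ler_peMr // exprn_ege1 // ltW.
have PL : fine (P L) <= expR (- (M * ((rho - 1) ^+ 2 / (4 * rho ^+ 2)))).
  apply: (lower_tail N_gt0 V_indep V_inv V_dim rho1 y1 mL) => w /negP.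
  by rewrite -ltNge => /ltW.
apply: (@le_trans _ _ (fine (P L) + fine (P U))); last lra.
rewrite -fineD ?fin_num_measure //.
apply: fine_le; rewrite ?fin_numD ?fin_num_measure //; first exact: measurableU.
exact: measureU2.
Qed.

End FrameEvents.

Lemma unit_weight_fusion_frameE (R : realType) (N K : nat)
    (W : 'I_K -> {vspace 'rV[R]_N}) (A B : R) :
  fusion_frame W (fun=> 1) A B <-> [/\ 0 < A, A <= B &
    forall x, A * dot x x <= frame_quad W x <= B * dot x x].
Proof.
have E x : \sum_(i < K) 1 ^+ 2 * enorm (orthproj (W i) x) ^+ 2 = frame_quad W x.
  by apply: eq_bigr => i _; rewrite expr1n mul1r enorm_sqr -dot_orthproj.
split=> [[_ A0 AB H]|[A0 AB H]]; split=> // x.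
  by have := H x; rewrite E enorm_sqr.
by rewrite E enorm_sqr.
Qed.

Definition decode (N L : nat) (f : {ffun 'I_N -> bool * 'I_L.+1})
    (i : 'I_N) : int :=
  if (f i).1 then - (f i).2%:Z else (f i).2%:Z.

Lemma decode_surj (N r : nat) (k : 'I_N -> int) : (\sum_i `|k i|%N <= r)%N ->
  exists2 f : {ffun 'I_N -> bool * 'I_r.+1}, f \in l1_ball_codes N r r &
    decode f =1 k.
Proof.
move=> kr; have kb i : (`|k i|%N < r.+1)%N.
  by rewrite ltnS (leq_trans _ kr) // (bigD1 i) //= leq_addr.
exists [ffun i => (k i < 0, Ordinal (kb i))].
  by rewrite inE; under eq_bigr do rewrite ffunE.
by move=> i; rewrite /decode ffunE /=; case: (ltP (k i) 0) => ?; lia.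
Qed.

Theorem theorem3p6 (R : realType) (d : measure_display) (T : measurableType d)
  (P : probability T R) (delta : R) (N K s : nat) (s_ : 'I_K -> nat)
  (V : 'I_K -> {RV P >-> subspaces R N})
  (delta_gt0 : 0 < delta) (N_gt0 : (0 < N)%N) (K_gt0 : (0 < K)%N)
  (s_gt0 : (0 < s)%N)
  (V_indep : independent_RVs V)
  (V_inv : forall k, unitarily_invariant (V k))
  (V_dim : forall k w, \dim (V k w : {vspace 'rV[R]_N}) = s_ k)
  (s_le : forall k, (s_ k <= s)%N) :
  let M : R := (\sum_(k < K) s_ k)%:R in
  let E : set T := [set w | fusion_frame (fun k => V k w) (fun=> 1)
                              (M / (N%:R * (1 + delta) ^+ 6))
                              (M * (1 + delta) ^+ 6 / N%:R)] in
  measurable E /\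
  ((1 - 2 * (1 + 4 / delta) ^+ N
          * expR (- (M * delta ^+ 2 / 4) + M * delta ^+ 3 / 3)
      - 2 * K%:R * (1 + 4 / delta) ^+ s
          * expR (- (N%:R * delta ^+ 2 / 4) + N%:R * delta ^+ 3 / 3))%:E
    <= P E)%E.
Proof.
move=> M E.
have N0 : 0 < N%:R :> R by rewrite ltr0n.
have M0 : 0 <= M by exact: ler0n.
have rho1 : 1 < 1 + delta by lra.
have rho0 : 0 < 1 + delta by lra.
set A := M / (N%:R * _) in E *; set B := _ / N%:R in E *.
have A0 : 0 <= A by rewrite divr_ge0 // mulr_ge0 ?exprn_ge0 // ltW.
have B0 : 0 <= B by rewrite divr_ge0 // mulr_ge0 // exprn_ge0 // ltW.
pose E' := [set w | forall x,
  A * dot x x <= frame_quad (fun k => V k w) x <= B * dot x x].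
have mE' : measurable E' by exact: measurable_frame_event.
have AB : A <= B.
  rewrite /A /B ler_pdivrMr ?mulr_gt0 ?exprn_gt0 //.
  rewrite (_ : _ * (N%:R * _) = M * ((1 + delta) ^+ 6) ^+ 2); last first.
    by field; rewrite gt_eqF.
  by rewrite ler_peMr // !exprn_ege1 // ltW.
have EE' : 0 < A -> E = E'.
  move=> A_gt0; apply/seteqP; split => w /=.
    by case/unit_weight_fusion_frameE.
  by move=> H; apply/unit_weight_fusion_frameE.
have mE : measurable E.
  have [A_gt0|A_le0] := ltP 0 A; first by rewrite EE'.
  rewrite (_ : E = set0) //; apply/seteqP.
  split => // w /unit_weight_fusion_frameE[].
  by rewrite ltNge A_le0.
split=> //.
pose q : R := 1 + 4 / delta.
pose e := expR (- (M * delta ^+ 2 / 4) + M * delta ^+ 3 / 3).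
have q1 : 1 <= q by rewrite lerDl divr_ge0 // ltW.
have q0 : 0 <= q by lra.
have e0 : 0 < e by exact: expR_gt0.
set last_term := 2 * K%:R * _ * _.
have last0 : 0 <= last_term by rewrite !mulr_ge0 ?expR_ge0 ?exprn_ge0.
rewrite -/q -/e -(fineK (fin_num_measure P _ mE)) lee_fin.
have PE0 : 0 <= fine (P E) by rewrite fine_ge0.
pose p := q ^+ N * e; have p0 : 0 < p by rewrite mulr_gt0 // exprn_gt0 //; lra.
rewrite -[2 * q ^+ N * e]mulrA -/p.
have [p2|p2] := leP (1 / 2) p; first by lra.
suff: 1 - 2 * p <= fine (P E) by lra.
(* [p < 1 / 2] forces the exponent of [e] to be negative, hence [delta < 3 / 4]
   and [0 < M] *)
have e_lt1 : e < 1.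
  apply: le_lt_trans (_ : e <= p) _; last lra.
  by rewrite /p ler_peMl ?exprn_ege1 // ltW.
have Mr : 0 < M * (delta ^+ 2 / 4 - delta ^+ 3 / 3).
  by move: e_lt1; rewrite /e -expR0 ltr_expR; lra.
have M_gt0 : 0 < M.
  by rewrite lt0r M0 andbT; apply: contraTneq Mr => ->; rewrite mul0r ltxx.
have d34 : delta < 3 / 4.
  move: Mr; rewrite pmulr_rgt0 //.
  rewrite (_ : _ - _ = delta ^+ 2 * (1 / 4 - delta / 3)); last by field.
  by rewrite pmulr_rgt0 ?exprn_gt0 //; lra.
have A_gt0 : 0 < A by rewrite divr_gt0 // mulr_gt0 // exprn_gt0.
rewrite EE' //.
have [n [n0 neps ncount]] := grid_parameter delta_gt0 d34.
pose w2 : R := (1 + delta) ^+ 2.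
have w1 : 1 < w2 by rewrite exprn_egt1.
pose beta := 2 * expR (- (M * ((w2 - 1) ^+ 2 / (4 * w2 ^+ 2)))).
pose a := M / (N%:R * w2 ^+ 2); pose b := w2 ^+ 2 * M / N%:R.
pose L := (n.+1 * N)%N.
pose Bad (f : {ffun 'I_N -> bool * 'I_L.+1}) :=
  let x := int_vec (decode f) : 'rV[R]_N in
  ~` [set w | a * dot x x <= frame_form V x w <= b * dot x x].
have mBad f : measurable (Bad f).
  by apply: measurableC; exact: measurable_frame_form_itv.
have good w : (forall f, f \in l1_ball_codes N L L -> ~ Bad f w) -> E' w.
  move=> H x.
  have lat (k : 'I_N -> int) : (\sum_i `|k i|%N)%:R <= (n%:R + 1) * N%:R :> R ->
      a * dot (int_vec k) (int_vec k) <= frame_quad (fun k => V k w) (int_vec k)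
        <= b * dot (int_vec k) (int_vec k).
    rewrite natr1 -natrM ler_nat => /decode_surj[f fA fk].
    have -> : int_vec k = int_vec (decode f) :> 'rV[R]_N.
      by apply/rowP => i; rewrite !mxE fk.
    by have /contrapT := H f fA.
  have a0 : 0 <= a by rewrite divr_ge0 // mulr_ge0 // sqr_ge0.
  have b0 : 0 <= b by rewrite divr_ge0 // mulr_ge0 // sqr_ge0.
  have /andP[lo up] := frame_bounds_of_lattice n0 a0 b0 lat N_gt0 x.
  have xx := dot_ge0 x.
  have MN : 0 <= M / N%:R by rewrite divr_ge0.
  have dimM : (\sum_(k < K) \dim (V k w : {vspace 'rV[R]_N}))%:R = M :> R.
    by rewrite /M; congr (_%:R); apply: eq_bigr => k _.
  apply/andP; split.
    apply: le_trans lo; rewrite dimM ler_wpM2r //.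
    have -> : a = M / N%:R * (1 + delta) ^- 4.
      by rewrite /a /w2 -exprM invfM mulrA.
    rewrite -mulrBr /A invfM mulrA ler_wpM2l //.
    exact: lower_margin.
  apply: le_trans up _; rewrite ler_wpM2r //.
  have -> : b = M / N%:R * (1 + delta) ^+ 4.
    by rewrite /b /w2; field; rewrite gt_eqF.
  have -> : B = M / N%:R * (1 + delta) ^+ 6 by rewrite /B mulrAC.
  rewrite -mulrA ler_wpM2l //.
  exact: upper_margin.
have beta_le f : f \in l1_ball_codes N L L -> fine (P (Bad f)) <= beta.
  by move=> _; exact: (vector_tail N_gt0 V_indep V_inv V_dim).
apply: le_trans (union_bound mE' mBad good beta_le).
rewrite lerD2l lerN2.
have card_le : #|l1_ball_codes N L L|%:R <= q ^+ 2 ^+ N.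
  apply: le_trans (card_l1_ball_codes N L n) _.
  by rewrite lerXn2r ?nnegrE ?exprn_ge0 //; have := ler0n R n; lra.
(* the tail exponent is at least twice that of [e], which pays for a grid of size
   [(q ^+ 2) ^+ N] *)
have beta_p : beta <= 2 * e ^+ 2.
  rewrite ler_pM2l // [leRHS]expr2 -expRD ler_expR.
  have := ler_wpM2l M0 (tail_rate_ge delta_gt0 d34); rewrite -/w2.
  lra.
apply: (@le_trans _ _ (q ^+ 2 ^+ N * (2 * e ^+ 2))).
  by apply: ler_pM => //; rewrite mulr_ge0 ?expR_ge0.
rewrite (_ : _ * _ = 2 * (p * p)); last first.
  by rewrite /p -exprM mulnC exprM; ring.
by rewrite ler_pM2l //; nra.
Qed.
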